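(* Let $0<a\le1/4$ be given, and let $b\gg1$ and $\delta>0$. Then the initial value problem for the positions $q_1,q_2$ and the momenta $p_1,p_2$, with $q=q_2-q_1$, $$\begin{aligned} q_1'&=(p_1+p_2e^{-q})^2, & q_1(0)&=-a,\\ q_2'&=(p_1e^{-q}+p_2)^2, & q_2(0)&=a>0,\\ p_1'&=-p_1p_2(p_1+p_2e^{-q})e^{-q}, & p_1(0)&=-b-\delta,\\ p_2'&=p_1p_2(p_1e^{-q}+p_2)e^{-q}, & p_2(0)&=b, \end{aligned}$$ has a unique smooth solution $(q_1,q_2,p_1,p_2)(t)$ with a finite lifespan $T$, which is the zero of $q=q_2-q_1$, and which satisfies the estimate $$T\lesssim\frac{1}{\delta\sqrt{2b(b+\delta)}}.$$ Furthermore: (1) $p_1=\frac{w-p}{2}<0$ is decreasing, $\lim_{t\to T^-}p_1(t)=-\infty$, and $-p_1\simeq p\simeq q^{-1/4}$; (2) $p_2=\frac{w+p}{2}>0$ is increasing, $\lim_{t\to T^-}p_2(t)=\infty$, and $p_2\simeq p\simeq q^{-1/4}$; here $p=p_2-p_1$ and $w=p_1+p_2$ are given by $$p=\Big(p_0^2+2z_1\Big[\tfrac{1+e^{-q}}{\sqrt{1-e^{-2q}}}-\tfrac{1+e^{-q_0}}{\sqrt{1-e^{-2q_0}}}\Big]\Big)^{1/2},\qquad w=-\Big(w_0^2+2z_1\Big[\tfrac{\sqrt{1-e^{-2q_0}}}{1+e^{-q_0}}-\tfrac{\sqrt{1-e^{-2q}}}{1+e^{-q}}\Big]\Big)^{1/2},$$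 with $q_0=2a$, $p_0=2b+\delta$, $w_0=-\delta$ and $z_1=b(b+\delta)(1-e^{-2q_0})^{1/2}$. (3) $w=p_1+p_2$ is decreasing from $w_0<0$ to $w_T$, where $$w_T:=\lim_{t\to T^-}w(t)=-\Big(\delta^2+2b(b+\delta)(1-e^{-2a})\Big)^{1/2}.$$ Finally, the 2-peakon $$u(x,t)=p_1(t)e^{-|x-q_1(t)|}+p_2(t)e^{-|x-q_2(t)|}$$ is a solution of the Novikov equation for $x\in\mathbb{R}$, $0<t<T$, with the asymmetric antipeakon-peakon initial profile $$u(x,0)=-(b+\delta)e^{-|x+a|}+be^{-|x-a|},\quad x\in\mathbb{R}.$$
   Context: The Novikov equation is $u_t+u^2u_x+\partial_x(1-\partial_x^2)^{-1}[u^3+\frac32uu_x^2]+(1-\partial_x^2)^{-1}[\frac12u_x^3]=0$. The condition $b\gg1$ means that $b$ is large. The symbol $\lesssim$ means $\le$ up to a positive multiplicative constant, and $\simeq$ means two-sided bounds up to positive multiplicative constants independent of $t$.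
   Formalization: In (2), ''p_2 is increasing'' fails near t=0 when b>(b+δ)e^{-2a}, since then p_2'(0)<0 (e.g. a=1/4, b=5, δ=1). Proved instead: p_2 is increasing on some [t_0,T), with t_0=0 whenever b≤(b+δ)e^{-2a}. *)

(* Defs.v *)
From Stdlib Require Import Reals.
From Coquelicot Require Import Coquelicot.
Open Scope R_scope.

Definition lifespan (T t : R) : Prop := 0 <= t < T.

(* Derivative relative to a set [D]; at an endpoint belonging to [D] it is the
   one-sided derivative. *)
Definition is_derive_on (D : R -> Prop) (f : R -> R) (t l : R) : Prop :=
  filterdiff f (within D (locally t)) (fun h => scal h l).

(* [F n] is the n-th derivative of [f] relative to [D]. *)
Definition smooth_on (D : R -> Prop) (f : R -> R) : Prop :=
  exists F : nat -> R -> R,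
    (forall t, D t -> F O t = f t) /\
    (forall n t, D t -> is_derive_on D (F n) t (F (S n) t)).

Definition increasing_on (D : R -> Prop) (f : R -> R) : Prop :=
  forall s t, D s -> D t -> s < t -> f s < f t.

Definition decreasing_on (D : R -> Prop) (f : R -> R) : Prop :=
  forall s t, D s -> D t -> s < t -> f t < f s.

Definition equivalent_on (D : R -> Prop) (f g : R -> R) : Prop :=
  exists c1 c2 : R, 0 < c1 /\ 0 < c2 /\
    forall t, D t -> c1 * g t <= f t <= c2 * g t.

Definition smooth_solution (a b delta T : R) (q1 q2 p1 p2 : R -> R) : Prop :=
  let q t := q2 t - q1 t in
  (smooth_on (lifespan T) q1 /\ smooth_on (lifespan T) q2 /\
   smooth_on (lifespan T) p1 /\ smooth_on (lifespan T) p2) /\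
  (q1 0 = - a /\ q2 0 = a /\ p1 0 = - b - delta /\ p2 0 = b) /\
  (forall t, lifespan T t ->
     is_derive_on (lifespan T) q1 t ((p1 t + p2 t * exp (- q t)) ^ 2) /\
     is_derive_on (lifespan T) q2 t ((p1 t * exp (- q t) + p2 t) ^ 2) /\
     is_derive_on (lifespan T) p1 t
       (- p1 t * p2 t * (p1 t + p2 t * exp (- q t)) * exp (- q t)) /\
     is_derive_on (lifespan T) p2 t
       (p1 t * p2 t * (p1 t * exp (- q t) + p2 t) * exp (- q t))).

Definition z1 (a b delta : R) : R :=
  b * (b + delta) * sqrt (1 - exp (- 2 * (2 * a))).

Definition p_formula (a b delta q : R) : R :=
  let q0 := 2 * a in
  let p0 := 2 * b + delta in
  sqrt (p0 ^ 2 + 2 * z1 a b delta *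
          ((1 + exp (- q)) / sqrt (1 - exp (- 2 * q))
           - (1 + exp (- q0)) / sqrt (1 - exp (- 2 * q0)))).

Definition w_formula (a b delta q : R) : R :=
  let q0 := 2 * a in
  let w0 := - delta in
  - sqrt (w0 ^ 2 + 2 * z1 a b delta *
            (sqrt (1 - exp (- 2 * q0)) / (1 + exp (- q0))
             - sqrt (1 - exp (- 2 * q)) / (1 + exp (- q)))).

Definition two_peakon (q1 q2 p1 p2 : R -> R) (x t : R) : R :=
  p1 t * exp (- Rabs (x - q1 t)) + p2 t * exp (- Rabs (x - q2 t)).

Definition is_RInt_line (f : R -> R) (l : R) : Prop :=
  is_RInt_gen f (Rbar_locally m_infty) (Rbar_locally p_infty) l.

Definition test_function (psi : R -> R) : Prop :=
  (forall n x, ex_derive_n psi n x) /\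
  (exists M, forall x, M <= Rabs x -> psi x = 0).

(* [g] is the distributional derivative of [f] on the line. *)
Definition is_weak_derive (f g : R -> R) : Prop :=
  forall psi, test_function psi ->
    exists I, is_RInt_line (fun x => f x * Derive psi x) (- I) /\
              is_RInt_line (fun x => g x * psi x) I.

(* [g] is (1 - d^2/dx^2)^{-1} f, which is the convolution of [f] with the
   Green function exp (- |x|) / 2. *)
Definition is_inv_helmholtz (f g : R -> R) : Prop :=
  forall x, is_RInt_line (fun y => / 2 * exp (- Rabs (x - y)) * f y) (g x).

(* Test functions on the open strip { (x, t) | 0 < t < T }. *)
Definition strip_test_function (T : R) (phi : R -> R -> R) : Prop :=
  (forall n x t, ex_diff_n phi n x t) /\
  (exists M alpha beta, 0 < alpha /\ beta < T /\
     forall x t, M <= Rabs x \/ t <= alpha \/ beta <= t -> phi x t = 0).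

(* Solution, in the sense of distributions on the strip, of
     u_t + u^2 u_x + d/dx (1 - d^2/dx^2)^{-1} [u^3 + 3/2 u u_x^2]
         + (1 - d^2/dx^2)^{-1} [1/2 u_x^3] = 0.
   Peakons are not differentiable at their crests, so u_x is the distributional
   derivative [ux]; [F] and [G] are the two nonlocal terms (before d/dx). *)
Definition novikov_solution (T : R) (u : R -> R -> R) : Prop :=
  exists ux F G : R -> R -> R,
    (forall t, 0 < t < T ->
       is_weak_derive (fun x => u x t) (fun x => ux x t) /\
       is_inv_helmholtz (fun x => u x t ^ 3 + 3 / 2 * u x t * ux x t ^ 2)
                        (fun x => F x t) /\
       is_inv_helmholtz (fun x => / 2 * ux x t ^ 3) (fun x => G x t)) /\
    (forall phi, strip_test_function T phi ->
       exists J : R -> R,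
         (forall t, 0 < t < T ->
            is_RInt_line
              (fun x => - u x t * Derive (fun s => phi x s) t
                        + u x t ^ 2 * ux x t * phi x t
                        - F x t * Derive (fun y => phi y t) x
                        + G x t * phi x t) (J t)) /\
         is_RInt J 0 T 0).

(* Main.v *)
(** With [e = exp (- q)], the products [p1 p2], [p ^ 2] and [w ^ 2] can be integrated
    as functions of [q], which leaves the scalar equation [q' = p w (1 - e ^ 2)], singular
    at [q = 0].  In the variable [x] with [x ^ 4 = tanh (q / 2)] one finds
    [p = sqrt (A x ^ 2 + B) / x] and [w = - sqrt (A - B x ^ 2)], with the same constant [A]
    in both, and [x' = - sqrt (A x ^ 2 + B) sqrt (A - B x ^ 2) e / 2]; this is regular and
    does not vanish at [x = 0], so [x] reaches [0] in finite time, and all limits and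
    asymptotics are read off at [x = 0].

    Any solution stays equal to this one by Gronwall's inequality, and cannot live
    beyond [T] since [p2] blows up there.

    For the Novikov equation, away from the crests one has pointwise
    [u ^ 2 u_x + F_x + G + sum (p_i' E_i) + sum (p_i q_i' sgn (x - q_i) E_i) = 0],
    where [E_i = exp (- |x - q_i|)] and [F], [G] are explicit piecewise
    combinations of exponentials.  Hence the spatial integral of the weak formulation
    against [phi] is minus the time derivative of the integral of [u phi]. *)

Require Import Defs.
From Stdlib Require Import Reals Lra Psatz.
From Coquelicot Require Import Coquelicot.
Open Scope R_scope.

(** * Primitives of piecewise functions, and integrals over the line *)

(** The conserved product [p1 p2 sqrt (1 - e ^ 2)] becomes [p1 p2 = - B (x ^ 2 + / x ^ 2) / 4] in
    the variable [x]. Since [4 p1 p2 = w ^ 2 - p ^ 2], the two terms are shared out between [w ^ 2]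
    and [p ^ 2], which leaves one common constant [A]. The fourth power is forced: near the
    collision [q'] behaves like a negative multiple of the power [3/4] of [q], which is not
    Lipschitz at [0], whereas the fourth root of [q] crosses [0] with nonzero speed. It is also the
    source of the exponent [- 1/4]. Existence thus reduces to one quadrature for [x] and one for
    [q1]; the other unknowns are explicit functions of these.

    A sign shapes the claim on [p2]: its derivative has the sign opposite to that of the crest value
    [u(q2) = p1 e + p2]. When [b > (b + delta) exp (- 2 * a)] this value is positive at time [0],
    and [p2] first decreases. Hence monotonicity is asserted from some time [t0] on, with [t0 = 0]
    if the initial crest value is nonpositive. *)

Ltac real_ring := match goal with |- @eq _ ?a ?b => change (@eq R a b) end; ring.

(** Phrased through integrals and not derivatives, so that [F] may have corners and [f] jumps at the
    crests. *)
Definition is_primitive (f F : R -> R) : Prop :=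
  forall a b, a <= b -> is_RInt f a b (F b - F a).

Lemma is_RInt_Chasles_R (f : R -> R) (a b c l1 l2 : R) :
  is_RInt f a b l1 -> is_RInt f b c l2 -> is_RInt f a c (l1 + l2).
Proof. exact (is_RInt_Chasles f a b c l1 l2). Qed.

Lemma filterlim_plus_R {T : Type} {F : (T -> Prop) -> Prop} {FF : Filter F}
  (f g : T -> R) (a b : R) :
  filterlim f F (locally a) -> filterlim g F (locally b) ->
  filterlim (fun x => f x + g x) F (locally (a + b)).
Proof.
  intros Hf Hg; eapply filterlim_comp_2; [exact Hf|exact Hg|].
  apply (filterlim_plus (K := R_AbsRing) (V := R_NormedModule) a b).
Qed.

Lemma filterlim_mult_R {T : Type} {F : (T -> Prop) -> Prop} {FF : Filter F}
  (f g : T -> R) (a b : R) :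
  filterlim f F (locally a) -> filterlim g F (locally b) ->
  filterlim (fun x => f x * g x) F (locally (a * b)).
Proof.
  intros Hf Hg; eapply filterlim_comp_2; [exact Hf|exact Hg|].
  apply (filterlim_mult (K := R_AbsRing) a b).
Qed.

Lemma filterlim_scal_R {T : Type} {F : (T -> Prop) -> Prop} {FF : Filter F}
  (f : T -> R) (c a : R) :
  filterlim f F (locally a) -> filterlim (fun x => c * f x) F (locally (c * a)).
Proof. intros Hf; apply filterlim_mult_R; [apply filterlim_const|exact Hf]. Qed.

Lemma is_primitive_derive (f F : R -> R) :
  (forall x, is_derive F x (f x)) -> (forall x, continuous f x) -> is_primitive f F.
Proof.
  intros HF Hf a b _.
  apply (is_RInt_derive F f a b); intros; auto.
Qed.

Lemma ex_derive_continuous_R (f : R -> R) (x : R) : ex_derive f x -> continuous f x.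
Proof. exact (ex_derive_continuous f x). Qed.

Lemma is_primitive_ex_derive (f F : R -> R) :
  (forall x, is_derive F x (f x)) -> (forall x, ex_derive f x) -> is_primitive f F.
Proof.
  intros HF Hf; apply is_primitive_derive; [exact HF|].
  intros x; now apply ex_derive_continuous_R.
Qed.

Lemma is_primitive_mult (f df g dg : R -> R) :
  (forall x, is_derive f x (df x)) -> (forall x, ex_derive df x) ->
  (forall x, is_derive g x (dg x)) -> (forall x, continuous dg x) ->
  is_primitive (fun x => df x * g x + f x * dg x) (fun x => f x * g x).
Proof.
  intros Hf Hdf Hg Hdg; apply is_primitive_derive; intros x.
  - apply (is_derive_mult f g); auto. intros; apply Rmult_comm.
  - apply (continuous_plus (V := R_NormedModule));
      apply (continuous_mult (K := R_AbsRing)); auto;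
      apply ex_derive_continuous_R; auto; eexists; auto.
Qed.

(** An integral ignores the value of [f] at [c], so the conditions on [f] are strict; those on [F]
    both include [c], which forces the two primitives to agree there. *)
Lemma is_primitive_glue (c : R) (f F l L r R' : R -> R) :
  is_primitive l L -> is_primitive r R' ->
  (forall x, x < c -> f x = l x) -> (forall x, c < x -> f x = r x) ->
  (forall x, x <= c -> F x = L x) -> (forall x, c <= x -> F x = R' x) ->
  is_primitive f F.
Proof.
  intros Hl Hr fl fr Fl Fr.
  assert (left : forall a b, a <= b -> b <= c -> is_RInt f a b (F b - F a)).
  { intros a b ab bc. rewrite (Fl b), (Fl a) by lra.
    apply is_RInt_ext with l; [|now apply Hl].
    intros x; rewrite Rmin_left, Rmax_right by lra; intros; symmetry; apply fl; lra. }
  assert (right : forall a b, a <= b -> c <= a -> is_RInt f a b (F b - F a)).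
  { intros a b ab bc. rewrite (Fr b), (Fr a) by lra.
    apply is_RInt_ext with r; [|now apply Hr].
    intros x; rewrite Rmin_left, Rmax_right by lra; intros; symmetry; apply fr; lra. }
  intros a b ab.
  destruct (Rle_dec b c); [now apply left|].
  destruct (Rle_dec c a); [now apply right|].
  replace (F b - F a) with ((F c - F a) + (F b - F c)) by ring.
  apply is_RInt_Chasles_R with c; [apply left|apply right]; lra.
Qed.

Lemma is_primitive_piecewise (c d : R) (f F l L m M r R' : R -> R) :
  c < d ->
  is_primitive l L -> is_primitive m M -> is_primitive r R' ->
  (forall x, x < c -> f x = l x) -> (forall x, c < x < d -> f x = m x) ->
  (forall x, d < x -> f x = r x) ->
  (forall x, x <= c -> F x = L x) -> (forall x, c <= x <= d -> F x = M x) ->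
  (forall x, d <= x -> F x = R' x) ->
  is_primitive f F.
Proof.
  intros cd Hl Hm Hr fl fm fr Fl Fm Fr.
  (* The right piece continues [m] to the left of [c], so that it is itself a gluing of [m] and [r]
     at the single point [d]. *)
  apply (is_primitive_glue c f F l L (fun x => if Rle_dec x c then m x else f x)
           (fun x => if Rle_dec x c then M x else F x)); auto.
  - apply (is_primitive_glue d _ _ m M r R'); auto; intros x Hx;
      destruct (Rle_dec x c); auto; try lra.
    + apply fm; lra.
    + apply Fm; lra.
  - intros x Hx; destruct (Rle_dec x c); auto; lra.
  - intros x Hx; destruct (Rle_dec x c); auto; apply Fm; lra.
Qed.

Lemma is_RInt_line_primitive (f F : R -> R) (la lb : R) :
  is_primitive f F ->
  filterlim F (Rbar_locally m_infty) (locally la) ->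
  filterlim F (Rbar_locally p_infty) (locally lb) ->
  is_RInt_line f (lb - la).
Proof.
  intros Hf Ha Hb P HP.
  assert (Hlim : filterlim (fun ab : R * R => F (snd ab) + -1 * F (fst ab))
     (filter_prod (Rbar_locally m_infty) (Rbar_locally p_infty)) (locally (lb + -1 * la))).
  { apply filterlim_plus_R; [|apply filterlim_scal_R].
    - eapply filterlim_comp; [apply filterlim_snd|exact Hb].
    - eapply filterlim_comp; [apply filterlim_fst|exact Ha]. }
  replace (lb - la) with (lb + -1 * la) in HP by ring.
  (* [is_primitive] speaks of ordered endpoints only; the half-lines [x < 0] and [0 < x] provide the
     order. *)
  assert (Hle : filter_prod (Rbar_locally m_infty) (Rbar_locally p_infty)
                  (fun ab : R * R => fst ab <= snd ab)).
  { exists (fun x => x < 0) (fun x => 0 < x); [now exists 0|now exists 0|].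
    simpl; intros; lra. }
  specialize (Hlim P HP). unfold filtermap in Hlim. unfold filtermapi.
  generalize (filter_and _ _ Hlim Hle). apply filter_imp.
  intros [x y] [H1 H2]; simpl in *.
  exists (F y - F x); split; [now apply Hf|].
  replace (F y - F x) with (F y + -1 * F x) by ring; exact H1.
Qed.

Lemma is_RInt_zero (f : R -> R) (a b : R) :
  (forall x, Rmin a b < x < Rmax a b -> f x = 0) -> is_RInt f a b 0.
Proof.
  intros Hf. apply is_RInt_ext with (fun _ => 0).
  { intros x Hx; symmetry; now apply Hf. }
  evar_last; [apply (is_RInt_const (V := R_NormedModule) a b 0)|].
  unfold scal; simpl; unfold mult; simpl; ring.
Qed.

Lemma is_RInt_extend (f : R -> R) (a b c d l : R) :
  c <= a -> a <= b -> b <= d -> (forall x, x < a \/ b < x -> f x = 0) ->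
  is_RInt f a b l -> is_RInt f c d l.
Proof.
  intros ca ab bd Hf Hl.
  assert (Hz : forall x y, x <= y -> (y <= a \/ b <= x) -> is_RInt f x y 0).
  { intros x y xy Hxy; apply is_RInt_zero; intros z.
    rewrite Rmin_left, Rmax_right by lra; intros; apply Hf; lra. }
  replace l with (0 + (l + 0)) by ring.
  apply is_RInt_Chasles_R with a; [apply Hz; lra|].
  apply is_RInt_Chasles_R with b; [exact Hl|apply Hz; lra].
Qed.

Lemma is_RInt_line_support (f : R -> R) (M l : R) :
  0 <= M -> (forall x, M <= Rabs x -> f x = 0) ->
  is_RInt f (- M) M l -> is_RInt_line f l.
Proof.
  intros M0 Hf Hl P HP.
  exists (fun x => x < - M) (fun x => M < x); [now exists (- M)|now exists M|].
  intros x y Hx Hy; exists l; split; [|now apply locally_singleton]; simpl.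
  apply is_RInt_extend with (- M) M; try lra; auto.
  intros z [Hz|Hz]; apply Hf; [rewrite Rabs_left|rewrite Rabs_pos_eq]; lra.
Qed.

(** On each side of [x] the kernel factors: [exp (- Rabs (x - y))] is [exp (c - x) exp (y - c)] for
    [y <= x] and [exp (x - c) exp (c - y)] for [y >= x]. So [x] leaves the integrals, and the two
    limits identify [P x] and [Q x] with the integrals over the half-lines below and above [x]. *)
Lemma is_inv_helmholtz_primitive (c : R) (f P Q : R -> R) :
  is_primitive (fun y => exp (y - c) * f y) P ->
  is_primitive (fun y => exp (c - y) * f y) (fun y => - Q y) ->
  filterlim P (Rbar_locally m_infty) (locally 0) ->
  filterlim Q (Rbar_locally p_infty) (locally 0) ->
  is_inv_helmholtz f (fun x => / 2 * (exp (c - x) * P x + exp (x - c) * Q x)).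
Proof.
  intros HP HQ LP LQ x.
  set (L := fun y => / 2 * exp (c - x) * P y).
  (* The additive constant makes [R'] agree with [L] at [y = x]. *)
  set (R' := fun y => / 2 * (exp (c - x) * P x + exp (x - c) * Q x)
                      - / 2 * exp (x - c) * Q y).
  assert (HL : is_primitive (fun y => / 2 * exp (c - x) * (exp (y - c) * f y)) L).
  { intros a b ab. replace (L b - L a) with (scal (/ 2 * exp (c - x)) (P b - P a))
      by (unfold L, scal; simpl; unfold mult; simpl; ring).
    apply (is_RInt_scal (fun y => exp (y - c) * f y)); now apply HP. }
  assert (HR : is_primitive (fun y => / 2 * exp (x - c) * (exp (c - y) * f y)) R').
  { intros a b ab. replace (R' b - R' a) with (scal (/ 2 * exp (x - c)) (- Q b - - Q a))
      by (unfold R', scal; simpl; unfold mult; simpl; ring).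
    apply (is_RInt_scal (fun y => exp (c - y) * f y)); now apply HQ. }
  set (F := fun y => if Rle_dec y x then L y else R' y).
  assert (HF : is_primitive (fun y => / 2 * exp (- Rabs (x - y)) * f y) F).
  { apply (is_primitive_glue x _ _ _ L _ R' HL HR).
    - intros y Hy. rewrite Rabs_pos_eq by lra.
      replace (- (x - y)) with ((c - x) + (y - c)) by ring. rewrite exp_plus; ring.
    - intros y Hy. rewrite Rabs_left by lra.
      replace (- - (x - y)) with ((x - c) + (c - y)) by ring. rewrite exp_plus; ring.
    - intros y Hy; unfold F; destruct (Rle_dec y x); auto; lra.
    - intros y Hy; unfold F; destruct (Rle_dec y x); auto.
      replace y with x by lra. unfold L, R'; ring. }
  set (v := / 2 * (exp (c - x) * P x + exp (x - c) * Q x)) in *.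
  replace v with (v - 0) by ring.
  apply (is_RInt_line_primitive _ F _ _ HF).
  - apply filterlim_ext_loc with L.
    { exists x; intros y Hy; unfold F; destruct (Rle_dec y x); auto; lra. }
    replace 0 with (/ 2 * exp (c - x) * 0) by ring.
    now apply filterlim_scal_R.
  - apply filterlim_ext_loc with R'.
    { exists x; intros y Hy; unfold F; destruct (Rle_dec y x); auto; lra. }
    apply filterlim_ext with (fun y => v + (- / 2 * exp (x - c)) * Q y).
    { intros y; unfold R'; fold v; ring. }
    assert (E : v + (- / 2 * exp (x - c)) * 0 = v) by ring.
    rewrite <- E; apply filterlim_plus_R; [rewrite E; apply filterlim_const|now apply filterlim_scal_R].
Qed.

(** * The nonlocal terms for a fixed two-peakon profile *)

Definition piecewise (c d : R) (l m r : R -> R) (x : R) : R :=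
  if Rle_dec x c then l x else if Rle_dec x d then m x else r x.

Lemma piecewise_left c d l m r x : x <= c -> piecewise c d l m r x = l x.
Proof. intros H; unfold piecewise; destruct (Rle_dec x c); [easy|lra]. Qed.

(** At [c] the left piece is chosen, so the middle formula holds on the closed interval only for
    pieces that join continuously. The [_open] variants also serve [u_x], which jumps at the
    crests. *)
Lemma piecewise_middle c d l m r x :
  l c = m c -> c <= x <= d -> piecewise c d l m r x = m x.
Proof.
  intros E H; unfold piecewise; destruct (Rle_dec x c).
  - replace x with c by lra; exact E.
  - destruct (Rle_dec x d); [easy|lra].
Qed.

Lemma piecewise_middle_open c d l m r x :
  c < x < d -> piecewise c d l m r x = m x.
Proof.
  intros H; unfold piecewise; destruct (Rle_dec x c); [lra|].
  destruct (Rle_dec x d); [easy|lra].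
Qed.

Lemma piecewise_right c d l m r x :
  c < d -> m d = r d -> d <= x -> piecewise c d l m r x = r x.
Proof.
  intros cd E H; unfold piecewise; destruct (Rle_dec x c); [lra|].
  destruct (Rle_dec x d); [|easy]. replace x with d by lra; exact E.
Qed.

Lemma piecewise_right_open c d l m r x :
  c < d -> d < x -> piecewise c d l m r x = r x.
Proof.
  intros cd H; unfold piecewise; destruct (Rle_dec x c); [lra|].
  destruct (Rle_dec x d); [lra|easy].
Qed.

Definition profile (p1 p2 q1 q2 x : R) : R :=
  p1 * exp (- Rabs (x - q1)) + p2 * exp (- Rabs (x - q2)).

Lemma profile_left (p1 p2 q1 q2 x : R) : q1 < q2 -> x <= q1 ->
  profile p1 p2 q1 q2 x = (p1 + p2 * exp (q1 - q2)) * exp (x - q1).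
Proof.
  intros q12 H; unfold profile. rewrite !Rabs_left1 by lra.
  replace (- - (x - q2)) with ((x - q1) + (q1 - q2)) by ring.
  replace (- - (x - q1)) with (x - q1) by ring. rewrite exp_plus; ring.
Qed.

Lemma profile_middle (p1 p2 q1 q2 x : R) : q1 <= x <= q2 ->
  profile p1 p2 q1 q2 x = p1 * exp (q1 - x) + p2 * exp (q1 - q2) * exp (x - q1).
Proof.
  intros H; unfold profile. rewrite Rabs_pos_eq, Rabs_left1 by lra.
  replace (- - (x - q2)) with ((x - q1) + (q1 - q2)) by ring.
  replace (- (x - q1)) with (q1 - x) by ring. rewrite exp_plus; ring.
Qed.

Lemma profile_right (p1 p2 q1 q2 x : R) : q1 < q2 -> q2 <= x ->
  profile p1 p2 q1 q2 x = (p1 * exp (q1 - q2) + p2) * exp (q2 - q1) * exp (q1 - x).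
Proof.
  intros q12 H; unfold profile. rewrite !Rabs_pos_eq by lra.
  replace (- (x - q2)) with ((q2 - q1) + (q1 - x)) by ring.
  replace (- (x - q1)) with ((q1 - q2) + ((q2 - q1) + (q1 - x))) by ring.
  rewrite !exp_plus; ring.
Qed.

Section Two_peakon_profile.

Variables p1 p2 q1 q2 : R.
Hypothesis q12 : q1 < q2.

Let k := exp (q1 - q2).
Let h := exp (q2 - q1).
Let X x := exp (x - q1).
Let V x := exp (q1 - x).
(** [m1] and [m2] are the crest values [u(q1)] and [u(q2)], whose squares are the velocities; [r] is
    the coefficient of [X] between the crests and [n] that of [V] to their right. *)
Let m1 := p1 + p2 * k.
Let m2 := p1 * k + p2.
Let r := p2 * k.
Let n := m2 * h.

Let u := profile p1 p2 q1 q2.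

(** At a crest this is the slope from the left, a choice that no integral sees. *)
Definition profile_dx : R -> R :=
  piecewise q1 q2 (fun x => m1 * X x) (fun x => - p1 * V x + r * X x) (fun x => - n * V x).

(* [PF x] is the integral of [exp (y - q1) f y] over [y < x] and [QF x] that of
   [exp (q1 - y) f y] over [y > x], for [f = u ^ 3 + 3 / 2 u u_x ^ 2], on each of the
   three regions cut by the crests; [PG] and [QG] are the same for [1 / 2 u_x ^ 3]. *)
Let PFl x := 5 / 8 * m1 ^ 3 * X x ^ 4.
Let PFm x := 5 / 8 * m1 ^ 3 + 5 / 4 * p1 ^ 3 * (1 - V x ^ 2)
  + 3 / 2 * p1 ^ 2 * r * (x - q1) + 3 / 4 * p1 * r ^ 2 * (X x ^ 2 - 1)
  + 5 / 8 * r ^ 3 * (X x ^ 4 - 1).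
Let PFr x := PFm q2 + 5 / 4 * n ^ 3 * (k ^ 2 - V x ^ 2).
Let QFr x := 5 / 8 * n ^ 3 * V x ^ 4.
Let QFm x := 5 / 8 * m2 ^ 3 * k + 5 / 8 * p1 ^ 3 * (V x ^ 4 - k ^ 4)
  + 3 / 4 * p1 ^ 2 * r * (V x ^ 2 - k ^ 2) + 3 / 2 * p1 * r ^ 2 * (q2 - x)
  + 5 / 4 * r ^ 3 * (h ^ 2 - X x ^ 2).
Let QFl x := QFm q1 + 5 / 4 * m1 ^ 3 * (1 - X x ^ 2).

Let PGl x := 1 / 8 * m1 ^ 3 * X x ^ 4.
Let PGm x := 1 / 8 * m1 ^ 3 - 1 / 4 * p1 ^ 3 * (1 - V x ^ 2)
  + 3 / 2 * p1 ^ 2 * r * (x - q1) - 3 / 4 * p1 * r ^ 2 * (X x ^ 2 - 1)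
  + 1 / 8 * r ^ 3 * (X x ^ 4 - 1).
Let PGr x := PGm q2 - 1 / 4 * n ^ 3 * (k ^ 2 - V x ^ 2).
Let QGr x := - (1 / 8) * n ^ 3 * V x ^ 4.
Let QGm x := - (1 / 8) * m2 ^ 3 * k - 1 / 8 * p1 ^ 3 * (V x ^ 4 - k ^ 4)
  + 3 / 4 * p1 ^ 2 * r * (V x ^ 2 - k ^ 2) - 3 / 2 * p1 * r ^ 2 * (q2 - x)
  + 1 / 4 * r ^ 3 * (h ^ 2 - X x ^ 2).
Let QGl x := QGm q1 + 1 / 4 * m1 ^ 3 * (1 - X x ^ 2).

Let PF := piecewise q1 q2 PFl PFm PFr.
Let QF := piecewise q1 q2 QFl QFm QFr.
Let PG := piecewise q1 q2 PGl PGm PGr.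
Let QG := piecewise q1 q2 QGl QGm QGr.

Definition profile_F (x : R) : R := / 2 * (V x * PF x + X x * QF x).
Definition profile_G (x : R) : R := / 2 * (V x * PG x + X x * QG x).

Lemma exp_gap_mult : k * h = 1.
Proof. unfold k, h; rewrite <- exp_plus; replace (q1 - q2 + (q2 - q1)) with 0 by ring; apply exp_0. Qed.
Lemma exp_gap_pos : 0 < k. Proof. apply exp_pos. Qed.
Lemma exp_gap_inv : h = / k. Proof. generalize exp_gap_mult exp_gap_pos; intros; field_simplify_eq; lra. Qed.
Lemma X_pos x : 0 < X x. Proof. apply exp_pos. Qed.
Lemma V_X x : V x = / X x.
Proof. unfold V, X; rewrite <- exp_Ropp; f_equal; ring. Qed.
Lemma X_q1 : X q1 = 1.
Proof. unfold X; rewrite Rminus_diag; apply exp_0. Qed.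
Lemma V_q2 : V q2 = k. Proof. reflexivity. Qed.
Lemma X_q2 : X q2 = h. Proof. reflexivity. Qed.

Lemma profile_u_left x : x <= q1 -> u x = m1 * X x.
Proof. now apply profile_left. Qed.
Lemma profile_u_middle x : q1 <= x <= q2 -> u x = p1 * V x + r * X x.
Proof. now apply profile_middle. Qed.
Lemma profile_u_right x : q2 <= x -> u x = n * V x.
Proof. now apply profile_right. Qed.

Ltac profile_fold :=
  change (exp (q1 - q2)) with k; change (exp (q2 - q1)) with h;
  repeat match goal with
  | |- context [exp (?y - q1)] => change (exp (y - q1)) with (X y)
  | |- context [exp (q1 - ?y)] => change (exp (q1 - y)) with (V y) end.

(** With [V = / X], [h = / k] and [X q1 = 1], every identity between the explicit pieces becomes a
    rational one in [X x], [k] and the momenta. *)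
Ltac profile_field :=
  rewrite ?X_q1, ?X_q2, ?V_q2, ?V_X, ?X_q1, ?exp_gap_inv; unfold n, m2, m1, r; rewrite ?exp_gap_inv;
  generalize exp_gap_pos; repeat match goal with |- context [X ?y] => generalize (X_pos y); generalize (X y) end;
  intros; field; lra.

Ltac profile_derive :=
  unfold X, V; auto_derive; [repeat split|];
  unfold Rminus;
  repeat match goal with
    |- context [exp (?y + - q1)] => change (exp (y + - q1)) with (X y) |
    |- context [exp (q1 + - ?y)] => change (exp (q1 + - y)) with (V y) end.

Let f y := u y ^ 3 + 3 / 2 * u y * profile_dx y ^ 2.
Let g y := / 2 * profile_dx y ^ 3.

(** Between the crests [u = v + z] and [u_x = z - v] with [v = p1 V] and [z = r X], whence [f = 5/2
    v^3 + 3/2 v^2 z + 3/2 v z^2 + 5/2 z^3]. Since [V X = 1], multiplying by [X] makes the [v^2 z]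
    term constant, which is the origin of the linear term of [PFm]. Outside the crests
    [u_x ^ 2 = u ^ 2], so [f = 5/2 u^3]. *)
Lemma PF_primitive : is_primitive (fun y => exp (y - q1) * f y) PF.
Proof.
  apply (is_primitive_piecewise q1 q2 _ _ (fun x => 5 / 2 * m1 ^ 3 * X x ^ 4) PFl
    (fun x => 5 / 2 * p1 ^ 3 * V x ^ 2 + 3 / 2 * p1 ^ 2 * r
       + 3 / 2 * p1 * r ^ 2 * X x ^ 2 + 5 / 2 * r ^ 3 * X x ^ 4) PFm
    (fun x => 5 / 2 * n ^ 3 * V x ^ 2) PFr q12).
  1, 2, 3: apply is_primitive_ex_derive; intros x;
    [unfold PFr, PFl, PFm; profile_derive; profile_field
    |unfold X, V; auto_derive; exact I].
  all: intros x Hx; fold (X x); unfold PF, f, profile_dx.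
  - rewrite profile_u_left, piecewise_left by lra. profile_field.
  - rewrite profile_u_middle, piecewise_middle_open by lra. profile_field.
  - rewrite profile_u_right, piecewise_right_open by lra. profile_field.
  - now apply piecewise_left.
  - apply piecewise_middle; auto. unfold PFl, PFm. profile_field.
  - apply piecewise_right; auto. unfold PFr, PFm. profile_field.
Qed.

Lemma QF_primitive : is_primitive (fun y => exp (q1 - y) * f y) (fun y => - QF y).
Proof.
  apply (is_primitive_piecewise q1 q2 _ _ (fun x => 5 / 2 * m1 ^ 3 * X x ^ 2) (fun y => - QFl y)
    (fun x => 5 / 2 * p1 ^ 3 * V x ^ 4 + 3 / 2 * p1 ^ 2 * r * V x ^ 2
       + 3 / 2 * p1 * r ^ 2 + 5 / 2 * r ^ 3 * X x ^ 2) (fun y => - QFm y)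
    (fun x => 5 / 2 * n ^ 3 * V x ^ 4) (fun y => - QFr y) q12).
  1, 2, 3: apply is_primitive_ex_derive; intros x;
    [unfold QFr, QFl, QFm; profile_derive; profile_field
    |unfold X, V; auto_derive; exact I].
  all: intros x Hx; try (apply f_equal); fold (V x); unfold QF, f, profile_dx.
  - rewrite profile_u_left, piecewise_left by lra. profile_field.
  - rewrite profile_u_middle, piecewise_middle_open by lra. profile_field.
  - rewrite profile_u_right, piecewise_right_open by lra. profile_field.
  - now apply piecewise_left.
  - apply piecewise_middle; auto. unfold QFl, QFm. profile_field.
  - apply piecewise_right; auto. unfold QFr, QFm. profile_field.
Qed.

Lemma PG_primitive : is_primitive (fun y => exp (y - q1) * g y) PG.
Proof.
  apply (is_primitive_piecewise q1 q2 _ _ (fun x => 1 / 2 * m1 ^ 3 * X x ^ 4) PGl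
    (fun x => - (1 / 2) * p1 ^ 3 * V x ^ 2 + 3 / 2 * p1 ^ 2 * r
       - 3 / 2 * p1 * r ^ 2 * X x ^ 2 + 1 / 2 * r ^ 3 * X x ^ 4) PGm
    (fun x => - (1 / 2) * n ^ 3 * V x ^ 2) PGr q12).
  1, 2, 3: apply is_primitive_ex_derive; intros x;
    [unfold PGr, PGl, PGm; profile_derive; profile_field
    |unfold X, V; auto_derive; exact I].
  all: intros x Hx; fold (X x); unfold PG, g, profile_dx.
  - rewrite piecewise_left by lra. profile_field.
  - rewrite piecewise_middle_open by lra. profile_field.
  - rewrite piecewise_right_open by lra. profile_field.
  - now apply piecewise_left.
  - apply piecewise_middle; auto. unfold PGl, PGm. profile_field.
  - apply piecewise_right; auto. unfold PGr, PGm. profile_field.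
Qed.

Lemma QG_primitive : is_primitive (fun y => exp (q1 - y) * g y) (fun y => - QG y).
Proof.
  apply (is_primitive_piecewise q1 q2 _ _ (fun x => 1 / 2 * m1 ^ 3 * X x ^ 2) (fun y => - QGl y)
    (fun x => - (1 / 2) * p1 ^ 3 * V x ^ 4 + 3 / 2 * p1 ^ 2 * r * V x ^ 2
       - 3 / 2 * p1 * r ^ 2 + 1 / 2 * r ^ 3 * X x ^ 2) (fun y => - QGm y)
    (fun x => - (1 / 2) * n ^ 3 * V x ^ 4) (fun y => - QGr y) q12).
  1, 2, 3: apply is_primitive_ex_derive; intros x;
    [unfold QGr, QGl, QGm; profile_derive; profile_field
    |unfold X, V; auto_derive; exact I].
  all: intros x Hx; try (apply f_equal); fold (V x); unfold QG, g, profile_dx.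
  - rewrite piecewise_left by lra. profile_field.
  - rewrite piecewise_middle_open by lra. profile_field.
  - rewrite piecewise_right_open by lra. profile_field.
  - now apply piecewise_left.
  - apply piecewise_middle; auto. unfold QGl, QGm. profile_field.
  - apply piecewise_right; auto. unfold QGr, QGm. profile_field.
Qed.

Lemma X_pow_lim (c : R) : filterlim (fun x => c * X x ^ 4) (Rbar_locally m_infty) (locally 0).
Proof.
  assert (HX : filterlim X (Rbar_locally m_infty) (locally 0)).
  { apply (filterlim_comp _ _ _ (fun x => x + - q1) exp _ (Rbar_locally m_infty)).
    - intros P [M HM]; exists (M + q1); intros x Hx; apply HM; lra.
    - exact is_lim_exp_m. }
  replace 0 with (c * (0 * (0 * (0 * (0 * 1))))) by ring.
  repeat (apply filterlim_mult_R; try apply filterlim_const; try exact HX).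
Qed.

Lemma V_pow_lim (c : R) : filterlim (fun x => c * V x ^ 4) (Rbar_locally p_infty) (locally 0).
Proof.
  assert (HV : filterlim V (Rbar_locally p_infty) (locally 0)).
  { apply (filterlim_comp _ _ _ (fun x => q1 - x) exp _ (Rbar_locally m_infty)).
    - intros P [M HM]; exists (q1 - M); intros x Hx; apply HM; lra.
    - exact is_lim_exp_m. }
  replace 0 with (c * (0 * (0 * (0 * (0 * 1))))) by ring.
  repeat (apply filterlim_mult_R; try apply filterlim_const; try exact HV).
Qed.

Lemma profile_F_helmholtz :
  is_inv_helmholtz (fun y => u y ^ 3 + 3 / 2 * u y * profile_dx y ^ 2) profile_F.
Proof.
  apply is_inv_helmholtz_primitive; [exact PF_primitive|exact QF_primitive|..].
  - apply filterlim_ext_loc with PFl; [|apply X_pow_lim].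
    exists q1; intros x Hx; symmetry; apply piecewise_left; lra.
  - apply filterlim_ext_loc with QFr; [|apply V_pow_lim].
    exists q2; intros x Hx; symmetry; now apply piecewise_right_open.
Qed.

Lemma profile_G_helmholtz : is_inv_helmholtz (fun y => / 2 * profile_dx y ^ 3) profile_G.
Proof.
  apply is_inv_helmholtz_primitive; [exact PG_primitive|exact QG_primitive|..].
  - apply filterlim_ext_loc with PGl; [|apply X_pow_lim].
    exists q1; intros x Hx; symmetry; apply piecewise_left; lra.
  - apply filterlim_ext_loc with QGr; [|apply V_pow_lim].
    exists q2; intros x Hx; symmetry; now apply piecewise_right_open.
Qed.

(** * Integration by parts and the balance law at a fixed time *)

Let a1 := p1 * m1 ^ 2.
Let a2 := p2 * m2 ^ 2.
Let b1 := - p1 * p2 * m1 * k.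
Let b2 := p1 * p2 * m2 * k.

(** The product rule holds on each of the three pieces, and continuity of [u] at the crests lets the
    primitives join without boundary terms: the distributional derivative of [u] has no point
    masses. *)
Lemma profile_dx_primitive (phi dphi : R -> R) :
  (forall x, is_derive phi x (dphi x)) -> (forall x, continuous dphi x) ->
  is_primitive (fun x => profile_dx x * phi x + u x * dphi x) (fun x => u x * phi x).
Proof.
  intros Hphi Hdphi.
  apply (is_primitive_piecewise q1 q2 _ _
    (fun x => m1 * X x * phi x + (m1 * X x) * dphi x) (fun x => m1 * X x * phi x)
    (fun x => (- p1 * V x + r * X x) * phi x + (p1 * V x + r * X x) * dphi x)
    (fun x => (p1 * V x + r * X x) * phi x)
    (fun x => (- n * V x) * phi x + (n * V x) * dphi x) (fun x => n * V x * phi x) q12).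
  1: apply (is_primitive_mult (fun x => m1 * X x) (fun x => m1 * X x)); auto.
  3: apply (is_primitive_mult (fun x => p1 * V x + r * X x) (fun x => - p1 * V x + r * X x)); auto.
  5: apply (is_primitive_mult (fun x => n * V x) (fun x => - n * V x)); auto.
  1, 3, 5: intros x; profile_derive; profile_field.
  1, 2, 3: intros x; unfold X, V; auto_derive; exact I.
  all: intros x Hx; unfold profile_dx.
  - rewrite profile_u_left, piecewise_left by lra; ring.
  - rewrite profile_u_middle, piecewise_middle_open by lra; ring.
  - rewrite profile_u_right, piecewise_right_open by lra; ring.
  - now rewrite profile_u_left.
  - now rewrite profile_u_middle.
  - now rewrite profile_u_right.
Qed.

(* Here [a1 = p1 q1'], [a2 = p2 q2'], [b1 = p1'] and [b2 = p2'] along the flow: off the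
   crests, [(sum (p_i q_i' E_i) - F)_x = u ^ 2 u_x + G + sum (p_i' E_i)]. *)
Lemma profile_balance (phi dphi : R -> R) :
  (forall x, is_derive phi x (dphi x)) -> (forall x, continuous dphi x) ->
  is_primitive
    (fun x => (u x ^ 2 * profile_dx x + profile_G x + profile b1 b2 q1 q2 x) * phi x
              + (profile a1 a2 q1 q2 x - profile_F x) * dphi x)
    (fun x => (profile a1 a2 q1 q2 x - profile_F x) * phi x).
Proof.
  intros Hphi Hdphi.
  (* [Sl], [Sm], [Sr] are the pieces of [sum (p_i q_i' E_i) - F], and [sl], [sm], [sr] their
     derivatives. In the derivative of [V P + X Q] the terms [V P' + X Q'] cancel because [P' = X f]
     and [Q' = - V f], so only [- V P + X Q] remains. *)
  pose (Sl := fun x => (a1 + a2 * k) * X x - / 2 * (V x * PFl x + X x * QFl x)).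
  pose (sl := fun x => (a1 + a2 * k) * X x - / 2 * (- V x * PFl x + X x * QFl x)).
  pose (Sm := fun x => a1 * V x + a2 * k * X x - / 2 * (V x * PFm x + X x * QFm x)).
  pose (sm := fun x => - a1 * V x + a2 * k * X x - / 2 * (- V x * PFm x + X x * QFm x)).
  pose (Sr := fun x => (a1 * k + a2) * h * V x - / 2 * (V x * PFr x + X x * QFr x)).
  pose (sr := fun x => - (a1 * k + a2) * h * V x - / 2 * (- V x * PFr x + X x * QFr x)).
  apply (is_primitive_piecewise q1 q2 _ _
    (fun x => sl x * phi x + Sl x * dphi x) (fun x => Sl x * phi x)
    (fun x => sm x * phi x + Sm x * dphi x) (fun x => Sm x * phi x)
    (fun x => sr x * phi x + Sr x * dphi x) (fun x => Sr x * phi x) q12).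
  1, 2, 3: apply is_primitive_mult; auto.
  1, 3, 5: intros x; unfold Sl, sl, Sm, sm, Sr, sr, PFl, QFl, PFr, QFr, PFm, QFm;
    profile_derive; profile_field.
  1, 2, 3: intros x; unfold sl, sm, sr, PFl, QFl, PFr, QFr, PFm, QFm, X, V;
    auto_derive; exact I.
  all: intros x Hx.
  1, 2, 3: apply f_equal2; (apply f_equal2; [|reflexivity]).
  all: try (apply f_equal2; [|reflexivity]).
  all: unfold profile_F, profile_G, PF, QF, PG, QG, profile_dx.
  - rewrite profile_u_left, profile_left, !piecewise_left by lra. profile_fold.
    unfold sl, PGl, QGl, PFl, QFl, PFm, QFm, PGm, QGm, a1, a2, b1, b2. profile_field.
  - rewrite profile_left, !piecewise_left by lra. reflexivity.
  - rewrite profile_u_middle, profile_middle, !piecewise_middle_open by lra. profile_fold.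
    unfold sm, PFm, QFm, PGm, QGm, a1, a2, b1, b2. profile_field.
  - rewrite profile_middle, !piecewise_middle_open by lra. reflexivity.
  - rewrite profile_u_right, profile_right, !piecewise_right_open by lra. profile_fold.
    unfold sr, PGr, QGr, PFr, QFr, PFm, QFm, PGm, QGm, a1, a2, b1, b2. profile_field.
  - rewrite profile_right, !piecewise_right_open by lra. reflexivity.
  - rewrite profile_left, !piecewise_left by lra. reflexivity.
  - rewrite profile_middle, !piecewise_middle; auto.
    + unfold QFl, QFm. profile_field.
    + unfold PFl, PFm. profile_field.
  - rewrite profile_right, !piecewise_right; auto.
    + unfold QFr, QFm. profile_field.
    + unfold PFr, PFm. profile_field.
Qed.

End Two_peakon_profile.

(** * Weak derivatives and integrals along a moving crest *)

Definition partial_fst (f : R -> R -> R) (x t : R) : R := Derive (fun y => f y t) x.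
Definition partial_snd (f : R -> R -> R) (x t : R) : R := Derive (fun s => f x s) t.

Lemma Derive_support (f : R -> R) (M x : R) :
  (forall y, M <= Rabs y -> f y = 0) -> M < Rabs x -> Derive f x = 0.
Proof.
  intros Hf Hx. rewrite (Derive_ext_loc f (fun _ => 0)); [apply Derive_const|].
  assert (H : continuous Rabs x) by apply continuous_Rabs.
  generalize (H (fun z => M < z) (open_gt M _ Hx)); unfold filtermap.
  apply filter_imp; intros y Hy; apply Hf; lra.
Qed.

Lemma exp_Rabs_continuous (q x : R) : continuous (fun y => exp (- Rabs (y - q))) x.
Proof.
  apply continuous_exp_comp, (continuous_opp (fun y => Rabs (y - q))), continuous_Rabs_comp.
  apply ex_derive_continuous_R; auto_derive; exact I.
Qed.

Lemma continuous_mult_R (f g : R -> R) (x : R) :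
  continuous f x -> continuous g x -> continuous (fun y => f y * g y) x.
Proof. apply (continuous_mult (K := R_AbsRing)). Qed.

Lemma continuous_plus_R (f g : R -> R) (x : R) :
  continuous f x -> continuous g x -> continuous (fun y => f y + g y) x.
Proof. apply (continuous_plus (K := R_AbsRing) (V := R_NormedModule)). Qed.

Lemma profile_continuous (p1 p2 q1 q2 x : R) : continuous (profile p1 p2 q1 q2) x.
Proof.
  apply continuous_plus_R; apply continuous_mult_R;
    try apply continuous_const; apply exp_Rabs_continuous.
Qed.

Lemma is_RInt_lin (f g : R -> R) (a b c d lf lg : R) :
  is_RInt f a b lf -> is_RInt g a b lg ->
  is_RInt (fun x => c * f x + d * g x) a b (c * lf + d * lg).
Proof.
  intros Hf Hg. apply (is_RInt_plus (fun x => scal c (f x)) (fun x => scal d (g x)));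
    apply (is_RInt_scal (V := R_NormedModule)); assumption.
Qed.

(** Integrability of [u_x psi] is obtained indirectly, since [u_x] jumps: [u psi'] is continuous,
    and the sum of the two integrands has the primitive [u psi], which vanishes at both ends. *)
Lemma profile_weak_derive (p1 p2 q1 q2 : R) : q1 < q2 ->
  is_weak_derive (profile p1 p2 q1 q2) (profile_dx p1 p2 q1 q2).
Proof.
  intros q12 psi [Hpsi [M0 HM0]].
  set (u := profile p1 p2 q1 q2); set (ux := profile_dx p1 p2 q1 q2).
  (* The margin [1] is for the derivative of [psi]: [Derive_support] needs a strict inequality to
     have a whole neighbourhood outside the support. *)
  set (M := Rmax M0 0 + 1).
  assert (HM : M0 < M /\ 0 < M)
    by (unfold M; generalize (Rmax_l M0 0), (Rmax_r M0 0); lra).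
  assert (Zpsi : forall x, M <= Rabs x -> psi x = 0) by (intros; apply HM0; lra).
  assert (Zd : forall x, M <= Rabs x -> Derive psi x = 0)
    by (intros; apply (Derive_support psi M0); [auto|lra]).
  assert (D1 : forall x, is_derive psi x (Derive psi x))
    by (intros x; apply Derive_correct, (Hpsi 1%nat x)).
  assert (C1 : forall x, continuous (Derive psi) x)
    by (intros x; apply ex_derive_continuous_R, (Hpsi 2%nat x)).
  assert (Hsum : is_RInt (fun x => ux x * psi x + u x * Derive psi x) (- M) M 0).
  { replace 0 with (u M * psi M - u (- M) * psi (- M)).
    - apply (profile_dx_primitive p1 p2 q1 q2 q12 psi (Derive psi) D1 C1); lra.
    - rewrite (Zpsi M), (Zpsi (- M)); [ring|rewrite Rabs_left; lra|rewrite Rabs_pos_eq; lra]. }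
  assert (Hc : ex_RInt (fun x => u x * Derive psi x) (- M) M).
  { apply (ex_RInt_continuous (V := R_CompleteNormedModule)); intros x _.
    apply continuous_mult_R; [apply profile_continuous|apply C1]. }
  destruct Hc as [I HI].
  exists (- I); split; apply is_RInt_line_support with M; try lra.
  - intros x Hx; rewrite Zd by lra; ring.
  - rewrite Ropp_involutive; exact HI.
  - intros x Hx; rewrite Zpsi by lra; ring.
  - apply is_RInt_ext with (fun x =>
      1 * (ux x * psi x + u x * Derive psi x) + -1 * (u x * Derive psi x)).
    { intros x _; cbv beta; real_ring. }
    replace (- I) with (1 * 0 + -1 * I) by ring.
    now apply is_RInt_lin.
Qed.

(* The substitution [x = q + y] fixes the crest at [y = 0], so that the integrand
   becomes differentiable in time. *)
Definition moving_integral (psi : R -> R -> R) (N q t : R) : R :=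
  RInt (fun y => exp (- Rabs y) * psi (q + y) t) (- N) N.

(** After the substitution the support lies in [[- M - q, M - q]]. Enlarging this to [[- N, N]]
    gives bounds of integration that stay fixed while [q] moves with time. *)
Lemma moving_integral_shift (psi : R -> R -> R) (M N q t : R) :
  0 <= M -> M + Rabs q <= N ->
  (forall x, continuous (fun y => psi y t) x) ->
  (forall x, M <= Rabs x -> psi x t = 0) ->
  is_RInt (fun x => exp (- Rabs (x - q)) * psi x t) (- M) M (moving_integral psi N q t).
Proof.
  intros M0 HN Hc Hz.
  assert (Hq : - Rabs q <= q <= Rabs q)
    by (generalize (Rle_abs q) (Rle_abs (- q)); rewrite Rabs_Ropp; lra).
  assert (Hex : ex_RInt (fun x => exp (- Rabs (x - q)) * psi x t) (- M) M).
  { apply (ex_RInt_continuous (V := R_CompleteNormedModule)); intros x _.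
    apply continuous_mult_R; [apply exp_Rabs_continuous|apply Hc]. }
  destruct Hex as [l Hl].
  replace (moving_integral psi N q t) with l; [exact Hl|].
  symmetry; apply is_RInt_unique.
  apply is_RInt_ext with (fun y => scal 1 (exp (- Rabs ((1 * y + q) - q)) * psi (1 * y + q) t)).
  { intros y _. unfold scal; simpl; unfold mult; simpl.
    replace (1 * y + q - q) with y by ring. replace (1 * y + q) with (q + y) by ring. ring. }
  apply (is_RInt_comp_lin (V := R_NormedModule) (fun x => exp (- Rabs (x - q)) * psi x t)).
  apply is_RInt_extend with (- M) M; try lra; auto.
  intros z Hz'; rewrite Hz; [ring|].
  destruct Hz'; [rewrite Rabs_left|rewrite Rabs_pos_eq]; lra.
Qed.

Lemma ex_diff_n_differentiable (psi : R -> R -> R) (x t : R) :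
  (forall x t, ex_diff_n psi 1 x t) ->
  differentiable_pt_lim psi x t (partial_fst psi x t) (partial_snd psi x t).
Proof.
  intros H. apply filterdiff_differentiable_pt_lim.
  apply (is_derive_filterdiff psi x t (partial_fst psi) (partial_snd psi x t)).
  - apply filter_forall; intros u. apply Derive_correct, (H (fst u) (snd u)).
  - apply Derive_correct, (H x t).
  - apply continuity_2d_pt_filterlim. apply (H x t).
Qed.

Lemma is_derive_along (psi : R -> R -> R) (q : R -> R) (dq y t : R) :
  (forall x t, ex_diff_n psi 1 x t) -> is_derive q t dq ->
  is_derive (fun s => psi (q s + y) s) t
    (partial_fst psi (q t + y) t * dq + partial_snd psi (q t + y) t).
Proof.
  intros H Hq. apply is_derive_Reals.
  replace (partial_fst psi (q t + y) t * dq + partial_snd psi (q t + y) t)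
    with (partial_fst psi (q t + y) t * dq + partial_snd psi (q t + y) t * 1) by ring.
  apply (derivable_pt_lim_comp_2d psi (fun s => q s + y) (fun s => s)).
  - now apply ex_diff_n_differentiable.
  - apply is_derive_Reals. replace dq with (dq + 0) by ring.
    apply (is_derive_plus (K := R_AbsRing) (V := R_NormedModule) q (fun _ => y)); [exact Hq|].
    apply (is_derive_const (K := R_AbsRing) (V := R_NormedModule)).
  - apply derivable_pt_lim_id.
Qed.

Lemma continuous_along (psi : R -> R -> R) (q : R -> R) (t y : R) :
  (forall x t, continuity_2d_pt psi x t) -> continuous q t ->
  continuous (fun z : R * R => psi (q (fst z) + snd z) (fst z)) (t, y).
Proof.
  intros H Hq.
  apply (continuous_comp_2 (fun z : R * R => q (fst z) + snd z) (fun z => fst z) psi).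
  - apply (continuous_plus (K := R_AbsRing) (V := R_NormedModule)
             (fun z : R * R => q (fst z)) (fun z => snd z)).
    + apply (continuous_comp (fun z : R * R => fst z) q); [apply continuous_fst|exact Hq].
    + apply continuous_snd.
  - apply continuous_fst.
  - simpl. apply continuity_2d_pt_filterlim, H.
Qed.

Lemma is_derive_moving_integral (psi : R -> R -> R) (q dq : R -> R) (N t : R) :
  (forall x t, ex_diff_n psi 1 x t) ->
  locally t (fun s => is_derive q s (dq s)) -> continuous dq t ->
  is_derive (fun s => moving_integral psi N (q s) s) t
    (dq t * moving_integral (partial_fst psi) N (q t) t
     + moving_integral (partial_snd psi) N (q t) t).
Proof.
  intros Hpsi Hq Hdq.
  assert (Hqc : continuous q t).
  { apply ex_derive_continuous_R; exists (dq t); exact (locally_singleton _ _ Hq). }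
  assert (Hex : forall f : R -> R -> R, (forall x t, continuity_2d_pt f x t) -> forall s,
            ex_RInt (fun y => exp (- Rabs y) * f (q s + y) s) (- N) N).
  { intros f Hf s. apply (ex_RInt_continuous (V := R_CompleteNormedModule)).
    intros y _. apply continuous_mult_R.
    - apply continuous_ext with (fun y => exp (- Rabs (y - 0))).
      { intros z; now rewrite Rminus_0_r. } apply exp_Rabs_continuous.
    - apply (continuous_comp_2 (fun y => q s + y) (fun _ => s) f).
      + apply ex_derive_continuous_R; auto_derive; exact I.
      + apply continuous_const.
      + simpl. apply continuity_2d_pt_filterlim, Hf. }
  assert (Hx : forall x t, continuity_2d_pt (partial_fst psi) x t) by (intros x s; apply (Hpsi x s)).
  assert (Ht : forall x t, continuity_2d_pt (partial_snd psi) x t) by (intros x s; apply (Hpsi x s)).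
  assert (Hd : forall y, locally t (fun s =>
     is_derive (fun s => exp (- Rabs y) * psi (q s + y) s) s
      (exp (- Rabs y) * (partial_fst psi (q s + y) s * dq s + partial_snd psi (q s + y) s)))).
  { intros y; revert Hq; apply filter_imp; intros s Hs.
    apply (is_derive_scal (fun s => psi (q s + y) s)). now apply is_derive_along. }
  evar_last.
  - apply (is_derive_RInt_param (fun s y => exp (- Rabs y) * psi (q s + y) s) (- N) N t).
    + revert Hq; apply filter_imp; intros s Hs y _.
      eexists. apply (is_derive_scal (fun s => psi (q s + y) s)). apply is_derive_along; eauto.
    + intros y _.
      apply continuity_2d_pt_ext_loc with (fun s y =>
        exp (- Rabs y) * (partial_fst psi (q s + y) s * dq s + partial_snd psi (q s + y) s)).
      { destruct Hq as [eps Heps]; exists eps; intros u v Hu _.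
        symmetry; apply is_derive_unique.
        apply (is_derive_scal (fun s => psi (q s + v) s)).
        apply is_derive_along; [exact Hpsi|]. now apply Heps. }
      apply continuity_2d_pt_filterlim.
      apply (continuous_mult (K := R_AbsRing) (fun z : R * R => exp (- Rabs (snd z)))
         (fun z : R * R => partial_fst psi (q (fst z) + snd z) (fst z) * dq (fst z)
                           + partial_snd psi (q (fst z) + snd z) (fst z)) (t, y)).
      * apply (continuous_comp (fun z : R * R => snd z) (fun y => exp (- Rabs y))).
        { apply continuous_snd. }
        apply continuous_ext with (fun y => exp (- Rabs (y - 0))).
        { intros z; now rewrite Rminus_0_r. } apply exp_Rabs_continuous.
      * apply (continuous_plus (K := R_AbsRing) (V := R_NormedModule)
          (fun z : R * R => partial_fst psi (q (fst z) + snd z) (fst z) * dq (fst z))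
          (fun z : R * R => partial_snd psi (q (fst z) + snd z) (fst z))).
        { apply (continuous_mult (K := R_AbsRing)
           (fun z : R * R => partial_fst psi (q (fst z) + snd z) (fst z))
           (fun z : R * R => dq (fst z))).
          - now apply continuous_along.
          - apply (continuous_comp (fun z : R * R => fst z) dq); [apply continuous_fst|exact Hdq]. }
        now apply continuous_along.
    + apply filter_forall; intros s. apply Hex. intros x r; apply (Hpsi x r).
  - rewrite (RInt_ext _ (fun y => dq t * (exp (- Rabs y) * partial_fst psi (q t + y) t)
        + 1 * (exp (- Rabs y) * partial_snd psi (q t + y) t))).
    + apply is_RInt_unique.
      replace (moving_integral (partial_snd psi) N (q t) t)
        with (1 * moving_integral (partial_snd psi) N (q t) t) by ring.
      apply is_RInt_lin; apply (RInt_correct (V := R_CompleteNormedModule)); now apply Hex.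
    + intros y _. etransitivity.
      { apply is_derive_unique, (locally_singleton _ _ (Hd y)). } real_ring.
Qed.

(** * Weak solutions of the Novikov equation *)

Lemma moving_integral_zero (psi : R -> R -> R) (N q t : R) :
  (forall x, psi x t = 0) -> moving_integral psi N q t = 0.
Proof.
  intros H. apply is_RInt_unique.
  apply is_RInt_zero; intros x _; rewrite H; ring.
Qed.

Lemma open_interval_locally (P : R -> Prop) (a b t : R) :
  (forall s, a < s < b -> P s) -> a < t < b -> locally t P.
Proof.
  intros H [Ha Hb]. apply (locally_interval P t a b Ha Hb).
  intros y Hy1 Hy2; apply H; split; assumption.
Qed.

Lemma two_peakon_novikov (T : R) (q1 q2 p1 p2 : R -> R) :
  (forall t, 0 < t < T -> q1 t < q2 t) ->
  (forall t, 0 < t < T ->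
     is_derive q1 t ((p1 t + p2 t * exp (q1 t - q2 t)) ^ 2) /\
     is_derive q2 t ((p1 t * exp (q1 t - q2 t) + p2 t) ^ 2) /\
     is_derive p1 t (- p1 t * p2 t * (p1 t + p2 t * exp (q1 t - q2 t)) * exp (q1 t - q2 t)) /\
     is_derive p2 t (p1 t * p2 t * (p1 t * exp (q1 t - q2 t) + p2 t) * exp (q1 t - q2 t))) ->
  novikov_solution T (two_peakon q1 q2 p1 p2).
Proof.
  intros Hq Hd.
  exists (fun x t => profile_dx (p1 t) (p2 t) (q1 t) (q2 t) x),
         (fun x t => profile_F (p1 t) (p2 t) (q1 t) (q2 t) x),
         (fun x t => profile_G (p1 t) (p2 t) (q1 t) (q2 t) x).
  split.
  { intros t Ht; specialize (Hq t Ht); split; [|split].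
    - exact (profile_weak_derive _ _ _ _ Hq).
    - exact (profile_F_helmholtz _ _ _ _ Hq).
    - exact (profile_G_helmholtz _ _ _ _ Hq). }
  intros phi [Hphi [M0 [alpha [beta [Halpha [Hbeta Hz]]]]]].
  pose (Q1 := fun t => (p1 t + p2 t * exp (q1 t - q2 t)) ^ 2).
  pose (Q2 := fun t => (p1 t * exp (q1 t - q2 t) + p2 t) ^ 2).
  pose (P1 := fun t => - p1 t * p2 t * (p1 t + p2 t * exp (q1 t - q2 t)) * exp (q1 t - q2 t)).
  pose (P2 := fun t => p1 t * p2 t * (p1 t * exp (q1 t - q2 t) + p2 t) * exp (q1 t - q2 t)).
  assert (Ex : forall t, 0 < t < T ->
     ex_derive q1 t /\ ex_derive q2 t /\ ex_derive p1 t /\ ex_derive p2 t).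
  { intros t Ht; destruct (Hd t Ht) as (H1 & H2 & H3 & H4).
    repeat split; eexists; eauto. }
  assert (Bnd : forall q, (forall t, 0 < t < T -> ex_derive q t) ->
            exists C, forall t, alpha <= t <= beta -> Rabs (q t) <= C).
  { intros q Hqd. destruct (bounded_continuity (K := R_AbsRing) (V := R_NormedModule) q alpha beta)
      as [C HC].
    - intros t Ht; apply ex_derive_continuous_R, Hqd; lra.
    - exists C; intros t Ht; left; now apply HC. }
  destruct (Bnd q1) as [C1 HC1]; [intros; now apply Ex|].
  destruct (Bnd q2) as [C2 HC2]; [intros; now apply Ex|].
  set (M := Rmax M0 0 + 1).
  assert (HM : M0 < M /\ 0 < M)
    by (unfold M; generalize (Rmax_l M0 0), (Rmax_r M0 0); lra).
  (* Chosen so that [M + Rabs (q_i t) <= N] for all [t] in [[alpha, beta]], as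
     [moving_integral_shift] requires. *)
  set (N := M + Rmax C1 C2).
  assert (HN1 : M + C1 <= N) by (unfold N; generalize (Rmax_l C1 C2); lra).
  assert (HN2 : M + C2 <= N) by (unfold N; generalize (Rmax_r C1 C2); lra).
  set (px := partial_fst phi); set (pt := partial_snd phi).
  (* For [t] in [[alpha, beta]], [K t] is the integral of [u phi] over the line, each peakon being
     written in coordinates centred at its own crest. *)
  pose (K := fun t => p1 t * moving_integral phi N (q1 t) t + p2 t * moving_integral phi N (q2 t) t).
  pose (dK := fun t =>
    (P1 t * moving_integral phi N (q1 t) t
     + p1 t * (Q1 t * moving_integral px N (q1 t) t + moving_integral pt N (q1 t) t))
    + (P2 t * moving_integral phi N (q2 t) t
     + p2 t * (Q2 t * moving_integral px N (q2 t) t + moving_integral pt N (q2 t) t))).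
  assert (Zt : forall t, ~ (alpha <= t <= beta) ->
             forall x, phi x t = 0 /\ px x t = 0 /\ pt x t = 0).
  { intros t Ht x; split; [|split].
    - apply Hz; lra.
    - unfold px, partial_fst. rewrite (Derive_ext _ (fun _ => 0)); [apply Derive_const|].
      intros y; apply Hz; lra.
    - unfold pt, partial_snd. rewrite (Derive_ext_loc _ (fun _ => 0)); [apply Derive_const|].
      destruct (Rlt_dec t alpha).
      + apply open_interval_locally with (t - 1) alpha; [|lra].
        intros s Hs; apply Hz; lra.
      + apply open_interval_locally with beta (t + 1); [|lra].
        intros s Hs; apply Hz; lra. }
  assert (ZdK : forall t, ~ (alpha <= t <= beta) -> dK t = 0).
  { intros t Ht; unfold dK; rewrite !moving_integral_zero;
      try (intros x; now apply Zt). ring. }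
  assert (Zx : forall x t, M <= Rabs x -> phi x t = 0 /\ px x t = 0 /\ pt x t = 0).
  { intros x t Hx; split; [|split].
    - apply Hz; lra.
    - apply (Derive_support _ M0); [intros y Hy; apply Hz; lra|lra].
    - unfold pt, partial_snd. rewrite (Derive_ext _ (fun _ => 0)); [apply Derive_const|].
      intros s; apply Hz; lra. }
  assert (Cphi : forall t x, continuous (fun y => phi y t) x).
  { intros t x; apply ex_derive_continuous_R, (Hphi 1%nat x t). }
  assert (Cpx : forall t x, continuous (fun y => px y t) x).
  { intros t x; apply ex_derive_continuous_R, (Hphi 2%nat x t). }
  assert (Cpt : forall t x, continuous (fun y => pt y t) x).
  { intros t x; apply ex_derive_continuous_R, (Hphi 2%nat x t). }
  assert (CQ : forall t, 0 < t < T -> continuous Q1 t /\ continuous Q2 t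
             /\ continuous P1 t /\ continuous P2 t).
  { intros t Ht; destruct (Ex t Ht) as (H1 & H2 & H3 & H4).
    repeat split; apply ex_derive_continuous_R; unfold Q1, Q2, P1, P2;
      auto_derive; repeat split; assumption. }
  assert (Mov : forall psi, (forall x t, ex_diff_n psi 1 x t) -> forall t, 0 < t < T ->
    is_derive (fun s => moving_integral psi N (q1 s) s) t
     (Q1 t * moving_integral (partial_fst psi) N (q1 t) t
      + moving_integral (partial_snd psi) N (q1 t) t) /\
    is_derive (fun s => moving_integral psi N (q2 s) s) t
     (Q2 t * moving_integral (partial_fst psi) N (q2 t) t
      + moving_integral (partial_snd psi) N (q2 t) t)).
  { intros psi Hpsi t Ht; split; apply is_derive_moving_integral; try assumption;
      try (apply CQ; assumption); apply open_interval_locally with 0 T; auto;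
      intros s Hs; now apply Hd. }
  exists (fun t => - dK t); split.
  - intros t Ht; set (u := fun x => two_peakon q1 q2 p1 p2 x t).
    apply is_RInt_line_support with M; [lra| |].
    { intros x Hx; change (Derive (fun s => phi x s) t) with (pt x t);
        change (Derive (fun y => phi y t) x) with (px x t).
      destruct (Zx x t Hx) as (-> & -> & ->); ring. }
    destruct (Rle_dec alpha t) as [t1|t1]; [destruct (Rle_dec t beta) as [t2|t2]|].
    2, 3: rewrite ZdK by lra.
    2, 3: rewrite Ropp_0; apply is_RInt_zero; intros x _;
      change (Derive (fun s => phi x s) t) with (pt x t);
      change (Derive (fun y => phi y t) x) with (px x t);
      destruct (Zt t) with (x := x) as (-> & -> & ->); [lra|ring].
    set (b1 := P1 t); set (b2 := P2 t); set (a1 := p1 t * Q1 t); set (a2 := p2 t * Q2 t).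
    pose (E1 := fun x => exp (- Rabs (x - q1 t))); pose (E2 := fun x => exp (- Rabs (x - q2 t))).
    pose (Bal := fun x => (u x ^ 2 * profile_dx (p1 t) (p2 t) (q1 t) (q2 t) x
        + profile_G (p1 t) (p2 t) (q1 t) (q2 t) x + profile b1 b2 (q1 t) (q2 t) x) * phi x t
      + (profile a1 a2 (q1 t) (q2 t) x - profile_F (p1 t) (p2 t) (q1 t) (q2 t) x) * px x t).
    assert (HBal : is_RInt Bal (- M) M 0).
    { replace 0 with ((profile a1 a2 (q1 t) (q2 t) M - profile_F (p1 t) (p2 t) (q1 t) (q2 t) M) * phi M t
       - (profile a1 a2 (q1 t) (q2 t) (-M) - profile_F (p1 t) (p2 t) (q1 t) (q2 t) (-M)) * phi (-M) t).
      - apply (profile_balance (p1 t) (p2 t) (q1 t) (q2 t) (Hq t Ht) (fun x => phi x t) (fun x => px x t)).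
        + intros x; apply Derive_correct, (Hphi 1%nat x t).
        + intros x; apply Cpx.
        + lra.
      - assert (Z1 : phi M t = 0) by (apply Zx; rewrite Rabs_pos_eq; lra).
        assert (Z2 : phi (- M) t = 0) by (apply Zx; rewrite Rabs_left; lra).
        rewrite Z1, Z2; ring. }
    assert (Sh : forall psi, (forall x, continuous (fun y => psi y t) x) ->
      (forall x, M <= Rabs x -> psi x t = 0) ->
      is_RInt (fun x => E1 x * psi x t) (- M) M (moving_integral psi N (q1 t) t) /\
      is_RInt (fun x => E2 x * psi x t) (- M) M (moving_integral psi N (q2 t) t)).
    { intros psi Hc Hs; split; apply moving_integral_shift; auto; try lra.
      - assert (Rabs (q1 t) <= C1) by (apply HC1; lra). lra.
      - assert (Rabs (q2 t) <= C2) by (apply HC2; lra). lra. }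
    destruct (Sh phi) as [S1 S2]; [apply Cphi|intros; now apply Zx|].
    destruct (Sh px) as [S3 S4]; [apply Cpx|intros; now apply Zx|].
    destruct (Sh pt) as [S5 S6]; [apply Cpt|intros; now apply Zx|].
    (* The weak-form integrand is [Bal] minus the integrand of [dK]: the terms in [a1], [a2], [b1],
       [b2] cancel. As [Bal] has integral [0], the value [- dK t] is left. *)
    generalize (is_RInt_lin _ _ _ _ b1 1 _ _ S1
       (is_RInt_lin _ _ _ _ a1 (p1 t) _ _ S3 S5)); intros R1.
    generalize (is_RInt_lin _ _ _ _ b2 1 _ _ S2
       (is_RInt_lin _ _ _ _ a2 (p2 t) _ _ S4 S6)); intros R2.
    generalize (is_RInt_lin _ _ _ _ 1 (-1) _ _ HBal (is_RInt_lin _ _ _ _ 1 1 _ _ R1 R2)).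
    match goal with |- is_RInt _ _ _ ?l -> _ => replace l with (- dK t) end.
    2: { unfold dK, a1, a2, b1, b2; ring. }
    apply is_RInt_ext; intros x _.
    change (Derive (fun s => phi x s) t) with (pt x t);
      change (Derive (fun y => phi y t) x) with (px x t).
    unfold Bal, profile. fold (E1 x); fold (E2 x).
    change (two_peakon q1 q2 p1 p2 x t) with (u x).
    assert (Eu : u x = p1 t * E1 x + p2 t * E2 x) by reflexivity.
    rewrite Eu. real_ring.
  (* A strip test function may come with [beta < alpha]; it then vanishes identically. *)
  - destruct (Rle_dec alpha beta) as [ab|ab].
    + apply is_RInt_extend with alpha beta; try lra.
      { intros t Ht; rewrite ZdK; [ring|lra]. }
      replace 0 with (minus (- K beta) (- K alpha)).
      * apply (is_RInt_derive (V := R_CompleteNormedModule) (fun t => - K t) (fun t => - dK t));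
          intros t; rewrite Rmin_left, Rmax_right by lra; intros Ht.
        { apply (is_derive_opp K). unfold K, dK.
          destruct (Hd t) as (_ & _ & D1 & D2); [lra|].
          destruct (Mov phi (Hphi 1%nat) t) as [D3 D4]; [lra|].
          apply (is_derive_plus (K := R_AbsRing) (V := R_NormedModule)
            (fun t => p1 t * moving_integral phi N (q1 t) t)
            (fun t => p2 t * moving_integral phi N (q2 t) t)).
          - apply (is_derive_mult p1 (fun s => moving_integral phi N (q1 s) s)); auto.
            intros; apply Rmult_comm.
          - apply (is_derive_mult p2 (fun s => moving_integral phi N (q2 s) s)); auto.
            intros; apply Rmult_comm. }
        { apply (continuous_opp (K := R_AbsRing) (V := R_NormedModule) dK).
          destruct (CQ t) as (c1 & c2 & c3 & c4); [lra|].
          destruct (Ex t) as (_ & _ & c5 & c6); [lra|].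
          apply ex_derive_continuous_R in c5; apply ex_derive_continuous_R in c6.
          assert (CM : forall psi, (forall x t, ex_diff_n psi 1 x t) ->
            continuous (fun s => moving_integral psi N (q1 s) s) t /\
            continuous (fun s => moving_integral psi N (q2 s) s) t).
          { intros psi Hpsi; destruct (Mov psi Hpsi t) as [d1 d2]; [lra|].
            split; apply ex_derive_continuous_R; eexists; eauto. }
          destruct (CM phi) as [e1 e2]; [apply Hphi|].
          destruct (CM px) as [e3 e4]; [intros; apply (Hphi 2%nat x)|].
          destruct (CM pt) as [e5 e6]; [intros; apply (Hphi 2%nat x)|].
          unfold dK.
          repeat (assumption || apply continuous_plus_R || apply continuous_mult_R). }
      * assert (Z1 : forall q, moving_integral phi N q alpha = 0).
        { intros q; apply moving_integral_zero; intros x; apply Hz; lra. }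
        assert (Z2 : forall q, moving_integral phi N q beta = 0).
        { intros q; apply moving_integral_zero; intros x; apply Hz; lra. }
        unfold K; rewrite !Z1, !Z2; unfold minus, plus, opp; simpl; ring.
    + apply is_RInt_zero; intros t _; rewrite ZdK; [ring|lra].
Qed.

(** * Scalar autonomous equations *)

Lemma MVT_derive (f df : R -> R) (a b : R) : a <= b ->
  (forall x, a <= x <= b -> is_derive f x (df x)) ->
  exists c, a <= c <= b /\ f b - f a = df c * (b - a).
Proof.
  intros ab H. destruct (MVT_gen f a b df) as [c Hc].
  - intros x; rewrite Rmin_left, Rmax_right by lra; intros; apply H; lra.
  - intros x; rewrite Rmin_left, Rmax_right by lra; intros.
    apply continuity_pt_filterlim, ex_derive_continuous_R; eexists; now apply H.
  - rewrite Rmin_left, Rmax_right in Hc by lra; now exists c.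
Qed.

(* The solution is the inverse of the antiderivative of [1 / G]. *)
Lemma autonomous_solution (G : R -> R) (m M : R) :
  0 < m -> (forall x, continuous G x) -> (forall x, m <= G x <= M) ->
  exists X : R -> R, X 0 = 0 /\ forall s, is_derive X s (G (X s)).
Proof.
  intros m0 HG HmM.
  assert (HGp : forall x, 0 < G x) by (intros x; specialize (HmM x); lra).
  assert (M0 : 0 < M) by (specialize (HmM 0); lra).
  assert (HC : forall x, continuous (fun y => / G y) x).
  { intros x. apply continuous_Rinv_comp; [apply HG|]. specialize (HGp x); lra. }
  pose (tau := fun x => RInt (fun y => / G y) 0 x).
  assert (Htau : forall x, is_derive tau x (/ G x)).
  { intros x. apply (is_derive_RInt (V := R_NormedModule) (fun y => / G y) tau 0 x); [|apply HC].
    apply filter_forall; intros z. apply (RInt_correct (V := R_CompleteNormedModule)).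
    apply (ex_RInt_continuous (V := R_CompleteNormedModule)); intros; apply HC. }
  assert (tau0 : tau 0 = 0) by apply (RInt_point (V := R_CompleteNormedModule)).
  assert (Hinv : forall x, / M <= / G x).
  { intros x; apply Rinv_le_contravar; [apply HGp|apply HmM]. }
  (* The lower bound [/ M] on the slope of [tau] makes it onto the whole line, and its inverse
     Lipschitz with constant [M]. *)
  assert (Hslope : forall x y, x <= y -> / M * (y - x) <= tau y - tau x).
  { intros x y xy. destruct (MVT_derive tau (fun x => / G x) x y xy) as [c [_ ->]]; auto.
    apply Rmult_le_compat_r; [lra|apply Hinv]. }
  (* [IVT_gen] returns its witness in a [sig] type, so the inverse function is definable without
     choice. *)
  assert (Hsurj : forall s, { x | tau x = s }).
  { intros s. destruct (IVT_gen tau (- M * Rabs s) (M * Rabs s) s) as [x [_ Hx]].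
    - intros x; apply continuity_pt_filterlim, ex_derive_continuous_R; eexists; apply Htau.
    - assert (Hs : - Rabs s <= s <= Rabs s)
        by (generalize (Rle_abs s) (Rle_abs (- s)); rewrite Rabs_Ropp; lra).
      assert (0 <= M * Rabs s) by (apply Rmult_le_pos; [lra|apply Rabs_pos]).
      generalize (Hslope 0 (M * Rabs s) ltac:(lra)) (Hslope (- M * Rabs s) 0 ltac:(lra)).
      rewrite tau0.
      replace (/ M * (M * Rabs s - 0)) with (Rabs s) by (field; lra).
      replace (/ M * (0 - - M * Rabs s)) with (Rabs s) by (field; lra).
      intros; split; [eapply Rle_trans; [apply Rmin_l|]|eapply Rle_trans; [|apply Rmax_r]]; lra.
    - now exists x. }
  pose (X := fun s => proj1_sig (Hsurj s)).
  assert (HX : forall s, tau (X s) = s) by (intros s; exact (proj2_sig (Hsurj s))).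
  assert (Hlip : forall x y, Rabs (y - x) <= M * Rabs (tau y - tau x)).
  { intros x y. apply Rmult_le_reg_l with (/ M); [now apply Rinv_0_lt_compat|].
    rewrite <- Rmult_assoc, Rinv_l, Rmult_1_l by lra.
    destruct (Rle_dec x y) as [xy|xy].
    - specialize (Hslope x y xy).
      rewrite Rabs_pos_eq by lra. eapply Rle_trans; [exact Hslope|apply Rle_abs].
    - specialize (Hslope y x ltac:(lra)). rewrite (Rabs_minus_sym (tau y)).
      rewrite Rabs_left by lra.
      eapply Rle_trans; [|apply Rle_abs]. lra. }
  exists X; split.
  { assert (H := Hlip 0 (X 0)). rewrite HX, tau0, Rminus_diag, Rabs_R0, Rmult_0_r in H.
    generalize (Rabs_pos (X 0 - 0)); intros.
    destruct (Req_dec (X 0 - 0) 0) as [E|E]; [lra|].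
    apply Rabs_pos_lt in E; lra. }
  intros s; apply is_derive_Reals; intros eps Heps.
  assert (Hc : continuity_pt G (X s)) by (apply continuity_pt_filterlim, HG).
  destruct (Hc eps Heps) as [d [Hd Hcd]].
  assert (Hdm : 0 < d / M) by (apply Rdiv_lt_0_compat; lra).
  exists (mkposreal _ Hdm); intros h h0 Hh; simpl in Hh.
  (* The mean value theorem for [tau] turns the difference quotient of [X] into [G xi] with [xi]
     between [X s] and [X (s + h)]; the Lipschitz bound drives [xi] to [X s], and [G] is continuous
     there. *)
  destruct (MVT_gen tau (X s) (X (s + h)) (fun x => / G x)) as [xi [Hxi Heq]].
  { intros; apply Htau. }
  { intros; apply continuity_pt_filterlim, ex_derive_continuous_R; eexists; apply Htau. }
  rewrite !HX in Heq.
  assert (E : (X (s + h) - X s) / h = G xi).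
  { replace (X (s + h) - X s) with (G xi * h); [field; exact h0|].
    replace h with (/ G xi * (X (s + h) - X s)) at 1 by lra.
    field. specialize (HGp xi); lra. }
  rewrite E.
  assert (Hxs : Rabs (xi - X s) <= M * Rabs h).
  { assert (H := Hlip (X s) (X (s + h))). rewrite !HX in H.
    replace (s + h - s) with h in H by ring.
    eapply Rle_trans; [|exact H].
    apply Rabs_le; revert Hxi; unfold Rmin, Rmax; destruct (Rle_dec _ _) as [c|c]; intros.
    - rewrite Rabs_pos_eq by lra; lra.
    - rewrite Rabs_left by lra; lra. }
  assert (Hxd : Rabs (xi - X s) < d).
  { eapply Rle_lt_trans; [exact Hxs|].
    apply Rmult_lt_reg_r with (/ M); [now apply Rinv_0_lt_compat|].
    replace (M * Rabs h * / M) with (Rabs h) by (field; lra). exact Hh. }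
  destruct (Req_dec xi (X s)) as [->|Hne].
  { rewrite Rminus_diag, Rabs_R0; exact Heps. }
  apply (Hcd xi); split; [split; [exact I|auto]|exact Hxd].
Qed.

(** Composition with the projection onto [[0, c]] extends a vector field on that interval to the
    whole line with the same bounds, as [autonomous_solution] demands. *)
Definition clamp (c x : R) : R := Rmax 0 (Rmin x c).

Lemma clamp_bounds (c x : R) : 0 <= c -> 0 <= clamp c x <= c.
Proof.
  intros; unfold clamp, Rmax, Rmin.
  destruct (Rle_dec x c); destruct (Rle_dec _ _); lra.
Qed.

Lemma clamp_id (c x : R) : 0 <= x <= c -> clamp c x = x.
Proof. intros; unfold clamp; rewrite Rmin_left, Rmax_right; lra. Qed.

Lemma continuous_Rmax_0 (x : R) : continuous (Rmax 0) x.
Proof.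
  apply continuous_ext with (fun y => / 2 * (y + Rabs y)).
  { intros y; unfold Rmax; destruct (Rle_dec 0 y);
      [rewrite Rabs_pos_eq by lra|rewrite Rabs_left by lra]; lra. }
  apply (continuous_mult (K := R_AbsRing)); [apply continuous_const|].
  apply (continuous_plus (K := R_AbsRing) (V := R_NormedModule));
    [apply continuous_id|apply continuous_Rabs].
Qed.

Lemma continuous_clamp (c x : R) : continuous (clamp c) x.
Proof.
  apply (continuous_comp (fun y => Rmin y c) (Rmax 0)); [|apply continuous_Rmax_0].
  apply continuous_ext with (fun y => c + -1 * Rmax 0 (c - y)).
  { intros y; unfold Rmin, Rmax; destruct (Rle_dec y c); destruct (Rle_dec 0 (c - y)); lra. }
  apply (continuous_plus (K := R_AbsRing) (V := R_NormedModule)); [apply continuous_const|].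
  apply (continuous_mult (K := R_AbsRing)); [apply continuous_const|].
  apply (continuous_comp (fun y => c - y) (Rmax 0)); [|apply continuous_Rmax_0].
  apply ex_derive_continuous_R; auto_derive; exact I.
Qed.

(** The equation is run upwards from [0] to [x0] and then reversed in time, so that the collision is
    a starting point and [T] the travel time; the lower speed bound [m] gives [m * T <= x0]. Through
    the clamp, [y] is defined on the whole line, which makes its continuity at [0] and at [T]
    two-sided. *)
Lemma decreasing_to_zero (g : R -> R) (x0 m M : R) :
  0 < x0 -> 0 < m -> (forall x, 0 <= x <= x0 -> continuous g x) ->
  (forall x, 0 <= x <= x0 -> m <= g x <= M) ->
  exists (T : R) (y : R -> R), 0 < T /\ m * T <= x0 /\ y 0 = x0 /\ y T = 0 /\
    (forall t, continuous y t) /\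
    (forall s t, s < t -> y t < y s) /\
    (forall t, 0 <= t <= T -> is_derive y t (- g (y t))).
Proof.
  intros x0p m0 Hg HmM.
  destruct (autonomous_solution (fun x => g (clamp x0 x)) m M) as [X [X0 HX]]; auto.
  - intros x; apply (continuous_comp (clamp x0) g); [apply continuous_clamp|].
    apply Hg, clamp_bounds; lra.
  - intros x; apply HmM, clamp_bounds; lra.
  - assert (Hinc : forall s t, s <= t -> m * (t - s) <= X t - X s).
    { intros s t st. destruct (MVT_derive X _ s t st (fun x _ => HX x)) as [c [_ ->]].
      apply Rmult_le_compat_r; [lra|]. apply HmM, clamp_bounds; lra. }
    assert (HXc : forall t, continuous X t)
      by (intros t; apply ex_derive_continuous_R; eexists; apply HX).
    assert (Hs : 0 < x0 / m) by (apply Rdiv_lt_0_compat; lra).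
    destruct (IVT_gen X 0 (x0 / m) x0) as [T [HT1 HT2]].
    + intros x; apply continuity_pt_filterlim, HXc.
    + assert (H := Hinc 0 (x0 / m) ltac:(lra)). rewrite X0 in *.
      replace (m * (x0 / m - 0)) with x0 in H by (field; lra).
      rewrite Rmin_left, Rmax_right; lra.
    + rewrite Rmin_left, Rmax_right in HT1 by lra.
      assert (HT : 0 < T).
      { destruct HT1 as [[H|H] _]; [exact H|]. rewrite <- H, X0 in HT2; lra. }
      exists T, (fun t => X (T - t)). split; [exact HT|]. split; [|split; [|split; [|split; [|split]]]].
      * assert (H := Hinc 0 T ltac:(lra)). rewrite X0, HT2 in H; lra.
      * now rewrite Rminus_0_r.
      * now rewrite Rminus_diag.
      * intros t. apply (continuous_comp (fun t => T - t) X); [|apply HXc].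
        apply ex_derive_continuous_R; auto_derive; exact I.
      * intros s t st. assert (H := Hinc (T - t) (T - s) ltac:(lra)).
        assert (0 < m * (T - s - (T - t))) by (apply Rmult_lt_0_compat; lra). lra.
      * intros t Ht. evar_last.
        { apply (is_derive_comp X (fun t => T - t)); [apply HX|].
          instantiate (1 := -1). auto_derive; [exact I|ring]. }
        (* For [t] in [[0, T]] the solution stays in [[0, x0]], where the clamp is inactive. *)
        rewrite clamp_id; [unfold scal; simpl; unfold mult; simpl; ring|].
        assert (H1 := Hinc 0 (T - t) ltac:(lra)). assert (H2 := Hinc (T - t) T ltac:(lra)).
        assert (0 <= m * (T - t - 0)) by (apply Rmult_le_pos; lra).
        assert (0 <= m * (T - (T - t))) by (apply Rmult_le_pos; lra). lra.
Qed.

(** * The reduced momenta *)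

(* In the variable [x] with [x ^ 4 = tanh (q / 2)], the distance [q = q2 - q1]
   enters through [exp_neg_q x = exp (- q)], and the reduced equation
   [x' = - speed A B x] is regular up to the collision [x = 0]. *)
Definition exp_neg_q (x : R) : R := (1 - x ^ 4) / (1 + x ^ 4).
Definition mom_p (A B x : R) : R := sqrt (A * x ^ 2 + B) / x.
Definition mom_w (A B x : R) : R := - sqrt (A - B * x ^ 2).
Definition mom1 (A B x : R) : R := (mom_w A B x - mom_p A B x) / 2.
Definition mom2 (A B x : R) : R := (mom_w A B x + mom_p A B x) / 2.
Definition speed (A B x : R) : R :=
  / 2 * sqrt (A * x ^ 2 + B) * sqrt (A - B * x ^ 2) * exp_neg_q x.

Lemma one_plus_pow4 (x : R) : 0 < 1 + x ^ 4.
Proof. assert (0 <= (x ^ 2) ^ 2) by apply pow2_ge_0. nra. Qed.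

Lemma pow4_lt_1 (x : R) : 0 < x < 1 -> 0 < x ^ 4 < 1.
Proof. intros; split; [apply pow_lt; lra|]. apply pow_lt_1_compat; [lra|lia]. Qed.

Lemma exp_neg_q_bounds (x : R) : 0 < x < 1 -> 0 < exp_neg_q x < 1.
Proof.
  intros Hx; assert (H := pow4_lt_1 x Hx); unfold exp_neg_q; split.
  - apply Rdiv_lt_0_compat; lra.
  - apply (Rdiv_lt_1 (1 - x ^ 4)); lra.
Qed.

Lemma is_derive_exp_neg_q (x : R) :
  is_derive exp_neg_q x (- 8 * x ^ 3 / (1 + x ^ 4) ^ 2).
Proof.
  assert (H := one_plus_pow4 x). unfold exp_neg_q.
  auto_derive; [simpl in H; lra|]. field; simpl in *; lra.
Qed.

Section Reduced_momenta.

Variables A B x : R.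
Hypotheses (A_pos : 0 < A) (B_pos : 0 < B) (x_bounds : 0 < x < 1) (w_pos : 0 < A - B * x ^ 2).

Let s := sqrt (A * x ^ 2 + B).
Let v := sqrt (A - B * x ^ 2).
Let k := exp_neg_q x.

Lemma radicand_p_pos : 0 < A * x ^ 2 + B.
Proof. assert (0 < x ^ 2) by (apply pow_lt; lra). nra. Qed.
Lemma sqrt_p_pos : 0 < s. Proof. apply sqrt_lt_R0, radicand_p_pos. Qed.
Lemma sqrt_w_pos : 0 < v. Proof. apply sqrt_lt_R0, w_pos. Qed.
Lemma sqrt_p_sqr : s ^ 2 = A * x ^ 2 + B.
Proof. apply pow2_sqrt; left; apply radicand_p_pos. Qed.
Lemma sqrt_w_sqr : v ^ 2 = A - B * x ^ 2.
Proof. apply pow2_sqrt; left; apply w_pos. Qed.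

(** [4 p1 p2 = w ^ 2 - p ^ 2], where [A] cancels. As [x ^ 2 + / x ^ 2] equals
    [2 / sqrt (1 - k ^ 2)], this is the conservation of [p1 p2 sqrt (1 - k ^ 2)]. *)
Lemma mom_mult : mom1 A B x * mom2 A B x = - (B * (x ^ 2 + / x ^ 2) / 4).
Proof.
  unfold mom1, mom2, mom_p, mom_w; fold s v.
  replace ((- v - s / x) / 2 * ((- v + s / x) / 2)) with ((v ^ 2 - s ^ 2 / x ^ 2) / 4)
    by (field; lra).
  rewrite sqrt_p_sqr, sqrt_w_sqr; field; lra.
Qed.

Lemma mom_mult_neg : mom1 A B x * mom2 A B x < 0.
Proof.
  rewrite mom_mult. assert (0 < x ^ 2) by (apply pow_lt; lra).
  assert (0 < / x ^ 2) by (now apply Rinv_0_lt_compat). nra.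
Qed.

Lemma mom_p_pos : 0 < mom_p A B x.
Proof. apply Rdiv_lt_0_compat; [apply sqrt_p_pos|lra]. Qed.
Lemma mom_w_neg : mom_w A B x < 0.
Proof. unfold mom_w; fold v; generalize sqrt_w_pos; lra. Qed.

Lemma mom1_neg : mom1 A B x < 0.
Proof. unfold mom1; generalize mom_p_pos mom_w_neg; lra. Qed.
(** In [(w + p) / 2] the two terms have opposite signs, so the sign is taken from the product
    [p1 p2 < 0]. *)
Lemma mom2_pos : 0 < mom2 A B x.
Proof. generalize mom1_neg mom_mult_neg; nra. Qed.

Lemma mom_crest1_neg : mom1 A B x + mom2 A B x * k < 0.
Proof.
  assert (Hk := exp_neg_q_bounds x x_bounds); fold k in Hk.
  generalize mom1_neg mom2_pos mom_w_neg; unfold mom1, mom2; intros; nra.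
Qed.

(** The value is [w (1 + k) / 2 + p (1 - k) / 2], with [(1 + k) / 2 = 1 / (1 + x ^ 4)] and
    [(1 - k) / 2 = x ^ 4 / (1 + x ^ 4)]. *)
Lemma mom_crest2 : mom1 A B x * k + mom2 A B x = (x ^ 3 * s - v) / (1 + x ^ 4).
Proof.
  unfold mom1, mom2, mom_w, mom_p, k, exp_neg_q; fold s v.
  assert (H := one_plus_pow4 x). field; lra.
Qed.

Lemma is_derive_mom_p : is_derive (mom_p A B) x (- B / (s * x ^ 2)).
Proof.
  assert (H := radicand_p_pos); assert (H2 := sqrt_p_pos); assert (H3 := sqrt_p_sqr).
  unfold mom_p; auto_derive; [repeat split; simpl in *; lra|].
  replace (A * (x * (x * 1)) + B) with (A * x ^ 2 + B) by ring; fold s.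
  apply Rmult_eq_reg_r with (s * x ^ 2); [|apply Rgt_not_eq; apply Rmult_lt_0_compat; [lra|apply pow_lt; lra]].
  replace (- B / (s * x ^ 2) * (s * x ^ 2)) with (A * x ^ 2 - s ^ 2) by (rewrite H3; field; lra).
  field; lra.
Qed.

Lemma is_derive_mom_w : is_derive (mom_w A B) x (B * x / v).
Proof.
  assert (H := w_pos); assert (H2 := sqrt_w_pos).
  unfold mom_w; auto_derive; [simpl in *; lra|].
  replace (A + - (B * (x * (x * 1)))) with (A - B * x ^ 2) by ring; fold v.
  field; lra.
Qed.

Variables (y : R -> R) (t : R).
Hypotheses (y_t : y t = x) (y_derive : is_derive y t (- speed A B x)).

Lemma along_reduced (f : R -> R) (df l : R) :
  is_derive f x df -> df * (- speed A B x) = l -> is_derive (fun r => f (y r)) t l.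
Proof.
  intros Hf <-. rewrite Rmult_comm.
  apply (is_derive_comp f y); [rewrite y_t; exact Hf|exact y_derive].
Qed.

(** This is [k' = - k q']: the difference of the squared crest values factors as
    [(p2 ^ 2 - p1 ^ 2) (1 - k ^ 2)]. *)
Lemma is_derive_k_t : is_derive (fun r => exp_neg_q (y r)) t
  (- k * (mom2 A B x ^ 2 - mom1 A B x ^ 2) * (1 - k ^ 2)).
Proof.
  eapply along_reduced; [apply is_derive_exp_neg_q|].
  unfold mom1, mom2, mom_w, mom_p, speed, k, exp_neg_q; fold s v.
  assert (H := one_plus_pow4 x). field; lra.
Qed.

(** The difference of the two momentum equations; their sum is the equation for [w] in the next
    lemma. The two crest values add up to [w (1 + k)] and differ by [p (1 - k)]. *)
Lemma is_derive_p_t : is_derive (fun r => mom_p A B (y r)) t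
  (mom1 A B x * mom2 A B x * mom_w A B x * k * (1 + k)).
Proof.
  eapply along_reduced; [apply is_derive_mom_p|].
  rewrite mom_mult; unfold mom_w, speed, k, exp_neg_q; fold s v.
  assert (H := one_plus_pow4 x); assert (H2 := sqrt_p_pos); field; lra.
Qed.

Lemma is_derive_w_t : is_derive (fun r => mom_w A B (y r)) t
  (mom1 A B x * mom2 A B x * mom_p A B x * k * (1 - k)).
Proof.
  eapply along_reduced; [apply is_derive_mom_w|].
  rewrite mom_mult; unfold mom_p, speed, k, exp_neg_q; fold s v.
  assert (H := one_plus_pow4 x); assert (H2 := sqrt_w_pos); field; lra.
Qed.

Lemma is_derive_mom1_t : is_derive (fun r => mom1 A B (y r)) t
  (- mom1 A B x * mom2 A B x * (mom1 A B x + mom2 A B x * k) * k).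
Proof.
  evar_last.
  - apply is_derive_ext with (fun r => / 2 * (mom_w A B (y r) - mom_p A B (y r))).
    { intros r; unfold mom1, Rdiv; apply Rmult_comm. }
    apply is_derive_scal.
    apply (is_derive_minus (K := R_AbsRing) (V := R_NormedModule)
      (fun r => mom_w A B (y r)) (fun r => mom_p A B (y r))); [apply is_derive_w_t|apply is_derive_p_t].
  - unfold minus, plus, opp; simpl. unfold mom1, mom2. field.
Qed.

Lemma is_derive_mom2_t : is_derive (fun r => mom2 A B (y r)) t
  (mom1 A B x * mom2 A B x * (mom1 A B x * k + mom2 A B x) * k).
Proof.
  evar_last.
  - apply is_derive_ext with (fun r => / 2 * (mom_w A B (y r) + mom_p A B (y r))).
    { intros r; unfold mom2, Rdiv; apply Rmult_comm. }
    apply is_derive_scal.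
    apply (is_derive_plus (K := R_AbsRing) (V := R_NormedModule)
      (fun r => mom_w A B (y r)) (fun r => mom_p A B (y r))); [apply is_derive_w_t|apply is_derive_p_t].
  - unfold plus; simpl. unfold mom1, mom2. field.
Qed.

End Reduced_momenta.

(** * Smoothness and uniqueness for the peakon system *)

(* With [k = exp (- q)], the momenta and [k] form a closed polynomial system, so
   the algebra of polynomials in [(p1, p2, k)] is stable under differentiation
   along the flow. *)
Inductive flow_poly : Type :=
| Pconst (c : R)
| Pmom1
| Pmom2
| Pexp
| Padd (e f : flow_poly)
| Pmul (e f : flow_poly).

Fixpoint peval (e : flow_poly) (p1 p2 k : R) : R :=
  match e with
  | Pconst c => c
  | Pmom1 => p1
  | Pmom2 => p2
  | Pexp => k
  | Padd e f => peval e p1 p2 k + peval f p1 p2 k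
  | Pmul e f => peval e p1 p2 k * peval f p1 p2 k
  end.

Definition crest1 : flow_poly := Padd Pmom1 (Pmul Pmom2 Pexp).
Definition crest2 : flow_poly := Padd (Pmul Pmom1 Pexp) Pmom2.
Definition popp (e : flow_poly) : flow_poly := Pmul (Pconst (-1)) e.
Definition field1 : flow_poly := popp (Pmul (Pmul Pmom1 Pmom2) (Pmul crest1 Pexp)).
Definition field2 : flow_poly := Pmul (Pmul Pmom1 Pmom2) (Pmul crest2 Pexp).
Definition field_exp : flow_poly :=
  Pmul (Padd (Pmul crest1 crest1) (popp (Pmul crest2 crest2))) Pexp.

Fixpoint pderive (e : flow_poly) : flow_poly :=
  match e with
  | Pconst c => Pconst 0
  | Pmom1 => field1
  | Pmom2 => field2
  | Pexp => field_exp
  | Padd e f => Padd (pderive e) (pderive f)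
  | Pmul e f => Padd (Pmul (pderive e) f) (Pmul e (pderive f))
  end.

Definition flow_at (p1 p2 k : R -> R) (t : R) : Prop :=
  is_derive p1 t (peval field1 (p1 t) (p2 t) (k t)) /\
  is_derive p2 t (peval field2 (p1 t) (p2 t) (k t)) /\
  is_derive k t (peval field_exp (p1 t) (p2 t) (k t)).

Lemma is_derive_peval (p1 p2 k : R -> R) (t : R) (e : flow_poly) :
  flow_at p1 p2 k t ->
  is_derive (fun s => peval e (p1 s) (p2 s) (k s)) t (peval (pderive e) (p1 t) (p2 t) (k t)).
Proof.
  intros (H1 & H2 & H3); induction e as [c| | | |e IHe f IHf|e IHe f IHf];
    simpl pderive; try assumption.
  - exact (is_derive_const (K := R_AbsRing) (V := R_NormedModule) c t).
  - exact (is_derive_plus _ _ _ _ _ IHe IHf).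
  - exact (is_derive_mult _ _ _ _ _ IHe IHf Rmult_comm).
Qed.

Lemma peval_bounded (e : flow_poly) (M : R) : exists C, 0 <= C /\
  forall p1 p2 k, Rabs p1 <= M -> Rabs p2 <= M -> Rabs k <= M -> Rabs (peval e p1 p2 k) <= C.
Proof.
  induction e as [c| | | |e [C [HC IHe]] f [D [HD IHf]]|e [C [HC IHe]] f [D [HD IHf]]].
  - exists (Rabs c); split; [apply Rabs_pos|intros; simpl; lra].
  - exists (Rmax 0 M); split; [apply Rmax_l|].
    intros; simpl; eapply Rle_trans; [eassumption|apply Rmax_r].
  - exists (Rmax 0 M); split; [apply Rmax_l|].
    intros; simpl; eapply Rle_trans; [eassumption|apply Rmax_r].
  - exists (Rmax 0 M); split; [apply Rmax_l|].
    intros; simpl; eapply Rle_trans; [eassumption|apply Rmax_r].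
  - exists (C + D); split; [lra|]; intros; simpl.
    eapply Rle_trans; [apply Rabs_triang|]. apply Rplus_le_compat; auto.
  - exists (C * D); split; [now apply Rmult_le_pos|]; intros; simpl.
    rewrite Rabs_mult. apply Rmult_le_compat; auto using Rabs_pos.
Qed.

Lemma peval_lipschitz (e : flow_poly) (M : R) : exists L, 0 <= L /\
  forall p1 p2 k s1 s2 l, Rabs p1 <= M -> Rabs p2 <= M -> Rabs k <= M ->
    Rabs s1 <= M -> Rabs s2 <= M -> Rabs l <= M ->
    Rabs (peval e p1 p2 k - peval e s1 s2 l)
      <= L * (Rabs (p1 - s1) + Rabs (p2 - s2) + Rabs (k - l)).
Proof.
  assert (Hsum : forall p1 p2 k s1 s2 l, 0 <= Rabs (p1 - s1) /\ 0 <= Rabs (p2 - s2) /\ 0 <= Rabs (k - l))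
    by (intros; repeat split; apply Rabs_pos).
  induction e as [c| | | |e [L [HL IHe]] f [K [HK IHf]]|e [L [HL IHe]] f [K [HK IHf]]].
  - exists 0; split; [lra|]; intros; simpl. rewrite Rminus_diag, Rabs_R0; lra.
  - exists 1; split; [lra|]; intros; simpl. specialize (Hsum p1 p2 k s1 s2 l); lra.
  - exists 1; split; [lra|]; intros; simpl. specialize (Hsum p1 p2 k s1 s2 l); lra.
  - exists 1; split; [lra|]; intros; simpl. specialize (Hsum p1 p2 k s1 s2 l); lra.
  - exists (L + K); split; [lra|]; intros; simpl.
    replace (peval e p1 p2 k + peval f p1 p2 k - (peval e s1 s2 l + peval f s1 s2 l))
      with ((peval e p1 p2 k - peval e s1 s2 l) + (peval f p1 p2 k - peval f s1 s2 l)) by ring.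
    eapply Rle_trans; [apply Rabs_triang|]. rewrite Rmult_plus_distr_r.
    apply Rplus_le_compat; auto.
  - destruct (peval_bounded e M) as [C [HC Be]]; destruct (peval_bounded f M) as [D [HD Bf]].
    exists (L * D + C * K); split; [apply Rplus_le_le_0_compat; now apply Rmult_le_pos|].
    intros; simpl.
    replace (peval e p1 p2 k * peval f p1 p2 k - peval e s1 s2 l * peval f s1 s2 l)
      with ((peval e p1 p2 k - peval e s1 s2 l) * peval f p1 p2 k
            + peval e s1 s2 l * (peval f p1 p2 k - peval f s1 s2 l)) by ring.
    eapply Rle_trans; [apply Rabs_triang|]. rewrite !Rabs_mult.
    specialize (IHe p1 p2 k s1 s2 l ltac:(auto) ltac:(auto) ltac:(auto) ltac:(auto) ltac:(auto) ltac:(auto)).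
    specialize (IHf p1 p2 k s1 s2 l ltac:(auto) ltac:(auto) ltac:(auto) ltac:(auto) ltac:(auto) ltac:(auto)).
    specialize (Be s1 s2 l ltac:(auto) ltac:(auto) ltac:(auto)).
    specialize (Bf p1 p2 k ltac:(auto) ltac:(auto) ltac:(auto)).
    set (d := Rabs (p1 - s1) + Rabs (p2 - s2) + Rabs (k - l)) in *.
    replace ((L * D + C * K) * d) with ((L * d) * D + C * (K * d)) by ring.
    apply Rplus_le_compat; apply Rmult_le_compat; auto using Rabs_pos.
Qed.

Lemma eq_of_same_derive (f g d : R -> R) (t : R) : 0 <= t ->
  (forall s, 0 <= s <= t -> continuous f s) -> (forall s, 0 <= s <= t -> continuous g s) ->
  (forall s, 0 < s < t -> is_derive f s (d s)) -> (forall s, 0 < s < t -> is_derive g s (d s)) ->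
  f 0 = g 0 -> f t = g t.
Proof.
  intros t0 Cf Cg Df Dg E.
  destruct (MVT_gen (fun s => f s - g s) 0 t (fun _ => 0)) as [c [_ Hc]].
  - intros s; rewrite Rmin_left, Rmax_right by lra; intros Hs.
    replace 0 with (minus (d s) (d s)) by (unfold minus, plus, opp; simpl; ring).
    apply (is_derive_minus (K := R_AbsRing) (V := R_NormedModule) f g); auto.
  - intros s; rewrite Rmin_left, Rmax_right by lra; intros Hs.
    apply continuity_pt_filterlim.
    apply (continuous_minus (K := R_AbsRing) (V := R_NormedModule) f g); [apply Cf|apply Cg]; lra.
  - rewrite E in Hc; lra.
Qed.

(** [E exp (- K s)] has nonpositive derivative. Differentiability is asked for on the open interval
    only, because a competing solution has just a one-sided derivative at time [0]. *)
Lemma gronwall_zero (E dE : R -> R) (K t : R) : 0 <= t ->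
  (forall s, 0 <= s <= t -> continuous E s) ->
  (forall s, 0 < s < t -> is_derive E s (dE s)) ->
  (forall s, 0 <= s <= t -> dE s <= K * E s) ->
  E 0 = 0 -> E t <= 0.
Proof.
  intros t0 CE DE HE E0.
  destruct (MVT_gen (fun s => E s * exp (- K * s)) 0 t
     (fun s => dE s * exp (- K * s) + E s * (- K * exp (- K * s)))) as [c [Hct Hc]].
  - intros s; rewrite Rmin_left, Rmax_right by lra; intros Hs.
    apply (is_derive_mult E (fun s => exp (- K * s))); auto.
    + auto_derive; [exact I|ring].
    + intros; apply Rmult_comm.
  - intros s; rewrite Rmin_left, Rmax_right by lra; intros Hs.
    apply continuity_pt_filterlim, (continuous_mult (K := R_AbsRing) E (fun s => exp (- K * s)));
      [apply CE; lra|].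
    apply ex_derive_continuous_R; auto_derive; exact I.
  - rewrite Rmin_left, Rmax_right in Hct by lra.
    specialize (HE c Hct). rewrite E0 in Hc.
    assert (P1 := exp_pos (- K * c)); assert (P2 := exp_pos (- K * t)).
    assert (H : E t * exp (- K * t) <= 0).
    { replace (E t * exp (- K * t)) with ((dE c - K * E c) * exp (- K * c) * t) by lra.
      assert ((dE c - K * E c) * exp (- K * c) <= 0) by nra. nra. }
    nra.
Qed.

(** On [[0, t]] both trajectories stay in a common cube, where the polynomial field is Lipschitz,
    and Gronwall applies to their squared distance. *)
Lemma flow_unique (p1 p2 k s1 s2 l : R -> R) (t : R) : 0 <= t ->
  (forall r, 0 <= r <= t -> continuous p1 r /\ continuous p2 r /\ continuous k r) ->
  (forall r, 0 <= r <= t -> continuous s1 r /\ continuous s2 r /\ continuous l r) ->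
  (forall r, 0 < r < t -> flow_at p1 p2 k r) -> (forall r, 0 < r < t -> flow_at s1 s2 l r) ->
  p1 0 = s1 0 -> p2 0 = s2 0 -> k 0 = l 0 ->
  p1 t = s1 t /\ p2 t = s2 t /\ k t = l t.
Proof.
  intros t0 Cp Cs Fp Fs E1 E2 E3.
  assert (Bnd : forall f, (forall r, 0 <= r <= t -> continuous f r) ->
            exists C, forall r, 0 <= r <= t -> Rabs (f r) <= C).
  { intros f Hf. destruct (bounded_continuity (K := R_AbsRing) (V := R_NormedModule) f 0 t)
      as [C HC]; [exact Hf|].
    exists C; intros r Hr; left; now apply HC. }
  destruct (Bnd p1) as [M1 B1]; [intros; now apply Cp|].
  destruct (Bnd p2) as [M2 B2]; [intros; now apply Cp|].
  destruct (Bnd k) as [M3 B3]; [intros; now apply Cp|].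
  destruct (Bnd s1) as [M4 B4]; [intros; now apply Cs|].
  destruct (Bnd s2) as [M5 B5]; [intros; now apply Cs|].
  destruct (Bnd l) as [M6 B6]; [intros; now apply Cs|].
  pose (M := Rmax (Rmax M1 (Rmax M2 M3)) (Rmax M4 (Rmax M5 M6))).
  assert (HM : M1 <= M /\ M2 <= M /\ M3 <= M /\ M4 <= M /\ M5 <= M /\ M6 <= M).
  { unfold M, Rmax; repeat destruct (Rle_dec _ _); lra. }
  destruct (peval_lipschitz field1 M) as [L1 [HL1 Lip1]].
  destruct (peval_lipschitz field2 M) as [L2 [HL2 Lip2]].
  destruct (peval_lipschitz field_exp M) as [L3 [HL3 Lip3]].
  pose (E := fun r => (p1 r - s1 r) ^ 2 + (p2 r - s2 r) ^ 2 + (k r - l r) ^ 2).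
  pose (f := fun e r => peval e (p1 r) (p2 r) (k r) - peval e (s1 r) (s2 r) (l r)).
  pose (dE := fun r => 2 * (p1 r - s1 r) * f field1 r + 2 * (p2 r - s2 r) * f field2 r
                       + 2 * (k r - l r) * f field_exp r).
  assert (H : E t <= 0).
  (* The constant is [2 * 3]: each squared difference contributes [2 L_i N ^ 2], and [N ^ 2 <= 3 E]
     for the sum [N] of the three absolute differences. *)
  { apply (gronwall_zero E dE (6 * (L1 + L2 + L3)) t t0).
    - intros r Hr; destruct (Cp r Hr) as (c1 & c2 & c3); destruct (Cs r Hr) as (c4 & c5 & c6).
      assert (Sq : forall g h, continuous g r -> continuous h r ->
                 continuous (fun x => (g x - h x) ^ 2) r).
      { intros g h Hg Hh. apply (continuous_comp (fun x => g x - h x) (fun z => z ^ 2)).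
        - now apply (continuous_minus (K := R_AbsRing) (V := R_NormedModule) g h).
        - apply ex_derive_continuous_R; auto_derive; exact I. }
      unfold E. repeat apply (continuous_plus (K := R_AbsRing) (V := R_NormedModule)); now apply Sq.
    - intros r Hr; destruct (Fp r Hr) as (d1 & d2 & d3); destruct (Fs r Hr) as (d4 & d5 & d6).
      assert (Sq : forall g h dg dh, is_derive g r dg -> is_derive h r dh ->
                 is_derive (fun x => (g x - h x) ^ 2) r (2 * (g r - h r) * (dg - dh))).
      { intros g h dg dh Hg Hh.
        assert (Hgh : is_derive (fun x => g x - h x) r (dg - dh))
          by exact (is_derive_minus g h r dg dh Hg Hh).
        evar_last; [apply (is_derive_pow (fun x => g x - h x) 2 r (dg - dh) Hgh)|].
        simpl; ring. }
      unfold E, dE. repeat apply (is_derive_plus (K := R_AbsRing) (V := R_NormedModule)); now apply Sq.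
    - intros r Hr.
      specialize (B1 r Hr); specialize (B2 r Hr); specialize (B3 r Hr);
        specialize (B4 r Hr); specialize (B5 r Hr); specialize (B6 r Hr).
      specialize (Lip1 (p1 r) (p2 r) (k r) (s1 r) (s2 r) (l r) ltac:(lra) ltac:(lra)
        ltac:(lra) ltac:(lra) ltac:(lra) ltac:(lra)).
      specialize (Lip2 (p1 r) (p2 r) (k r) (s1 r) (s2 r) (l r) ltac:(lra) ltac:(lra)
        ltac:(lra) ltac:(lra) ltac:(lra) ltac:(lra)).
      specialize (Lip3 (p1 r) (p2 r) (k r) (s1 r) (s2 r) (l r) ltac:(lra) ltac:(lra)
        ltac:(lra) ltac:(lra) ltac:(lra) ltac:(lra)).
      fold (f field1 r) in Lip1; fold (f field2 r) in Lip2; fold (f field_exp r) in Lip3.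
      set (x1 := p1 r - s1 r) in *; set (x2 := p2 r - s2 r) in *; set (x3 := k r - l r) in *.
      unfold dE, E; fold x1 x2 x3.
      set (N := Rabs x1 + Rabs x2 + Rabs x3) in *.
      assert (Pr : forall z w L, 0 <= L -> Rabs z <= N -> Rabs w <= L * N -> 2 * z * w <= 2 * L * N ^ 2).
      { intros z w L HL Hz Hw.
        assert (H1 : z * w <= Rabs z * Rabs w) by (rewrite <- Rabs_mult; apply Rle_abs).
        assert (H2 : Rabs z * Rabs w <= N * (L * N))
          by (apply Rmult_le_compat; auto using Rabs_pos).
        nra. }
      assert (A1 := Rabs_pos x1); assert (A2 := Rabs_pos x2); assert (A3 := Rabs_pos x3).
      assert (P1 := Pr x1 _ L1 HL1 ltac:(unfold N; lra) Lip1).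
      assert (P2 := Pr x2 _ L2 HL2 ltac:(unfold N; lra) Lip2).
      assert (P3 := Pr x3 _ L3 HL3 ltac:(unfold N; lra) Lip3).
      assert (HN : N ^ 2 <= 3 * (x1 ^ 2 + x2 ^ 2 + x3 ^ 2)).
      { rewrite <- (pow2_abs x1), <- (pow2_abs x2), <- (pow2_abs x3).
        unfold N. generalize (pow2_ge_0 (Rabs x1 - Rabs x2)) (pow2_ge_0 (Rabs x1 - Rabs x3))
          (pow2_ge_0 (Rabs x2 - Rabs x3)). intros; nra. }
      assert (0 <= L1 + L2 + L3) by lra. nra.
    - unfold E; rewrite E1, E2, E3; ring. }
  unfold E in H. generalize (pow2_ge_0 (p1 t - s1 t)) (pow2_ge_0 (p2 t - s2 t)) (pow2_ge_0 (k t - l t)).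
  intros. repeat split; apply Rminus_diag_uniq; apply Rsqr_0_uniq; unfold Rsqr; lra.
Qed.

(** * One-sided derivatives on the lifespan, and uniqueness *)

Lemma within_lifespan_lim (T t : R) : is_filter_lim (within (lifespan T) (locally t)) t.
Proof. intros P HP; unfold within; revert HP; apply filter_imp; auto. Qed.

Lemma is_derive_on_of_is_derive (T : R) (f : R -> R) (t l : R) :
  lifespan T t -> is_derive f t l -> is_derive_on (lifespan T) f t l.
Proof.
  intros Ht Hf.
  assert (PF : ProperFilter (within (lifespan T) (locally t))).
  { split; [|apply within_filter, locally_filter].
    intros P HP; exists t. apply locally_singleton in HP; now apply HP. }
  apply (filterdiff_locally f t); [apply within_lifespan_lim|exact Hf].
Qed.

Lemma is_derive_on_interior (T : R) (f : R -> R) (t l : R) :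
  0 < t < T -> is_derive_on (lifespan T) f t l -> is_derive f t l.
Proof.
  intros Ht [Hl Hd]; split; [exact Hl|]. intros x Hx eps.
  assert (Hx' : is_filter_lim (within (lifespan T) (locally t)) x).
  { intros P HP; specialize (Hx P HP); unfold within; revert Hx; apply filter_imp; auto. }
  assert (HD : locally t (fun s => lifespan T s)).
  { apply (locally_interval _ t 0 T); [exact (proj1 Ht)|exact (proj2 Ht)|].
    intros s H1 H2; split; [left; exact H1|exact H2]. }
  specialize (Hd x Hx' eps); unfold within in Hd.
  generalize (filter_and _ _ HD Hd); apply filter_imp; intros s [H1 H2]; now apply H2.
Qed.

(** A solution is controlled only for [t >= 0]. Precomposing with [Rmax 0] freezes it at its initial
    value for negative times and turns one-sided continuity at [0] into ordinary continuity. *)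
Lemma is_derive_on_continuous (T : R) (f : R -> R) (t l : R) :
  lifespan T t -> is_derive_on (lifespan T) f t l ->
  continuous (fun s => f (Rmax 0 s)) t.
Proof.
  intros Ht Hf.
  assert (E : Rmax 0 t = t) by (apply Rmax_right, Ht).
  unfold continuous; rewrite E.
  apply filterlim_comp with (within (lifespan T) (locally t)).
  - intros P HP; unfold within in HP.
    assert (H := continuous_Rmax_0 t). unfold continuous in H; rewrite E in H.
    specialize (H _ HP); unfold filtermap in *.
    assert (HD : locally t (fun s => s < T)) by apply (open_lt T t (proj2 Ht)).
    generalize (filter_and _ _ H HD); apply filter_imp; intros s [H1 H2]; apply H1.
    split; [apply Rmax_l|]. apply Rmax_lub_lt; [|exact H2].
    destruct Ht; lra.
  - apply (filterdiff_continuous_aux (K := R_AbsRing) (U := AbsRing_NormedModule R_AbsRing)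
      (V := R_NormedModule) f).
    + eexists; exact Hf.
    + apply within_lifespan_lim.
Qed.

Lemma is_derive_Rmax_0 (f : R -> R) (t l : R) :
  0 < t -> is_derive f t l -> is_derive (fun s => f (Rmax 0 s)) t l.
Proof.
  intros Ht; apply is_derive_ext_loc.
  generalize (open_gt 0 t Ht); apply filter_imp; intros s Hs.
  rewrite Rmax_right; [reflexivity|left; exact Hs].
Qed.

(** [Ext] first rewrites any solution, frozen before time [0], as a trajectory of the closed system
    in the momenta and [exp (- q)]. Once these agree, [q1] and [q2] agree as well, since their
    derivatives are polynomials in them. *)
Lemma smooth_solution_unique (a b delta T T' : R) (q1 q2 p1 p2 r1 r2 s1 s2 : R -> R) :
  smooth_solution a b delta T q1 q2 p1 p2 ->
  smooth_solution a b delta T' r1 r2 s1 s2 ->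
  forall t, lifespan T t -> lifespan T' t ->
    r1 t = q1 t /\ r2 t = q2 t /\ s1 t = p1 t /\ s2 t = p2 t.
Proof.
  assert (Ext : forall T q1 q2 p1 p2, smooth_solution a b delta T q1 q2 p1 p2 ->
    let e f s := f (Rmax 0 s) in
    let k s := exp (- (q2 s - q1 s)) in
    forall t, lifespan T t ->
     (continuous (e q1) t /\ continuous (e q2) t /\ continuous (e p1) t /\
      continuous (e p2) t /\ continuous (e k) t) /\
     (0 < t -> is_derive (e q1) t (peval (Pmul crest1 crest1) (e p1 t) (e p2 t) (e k t)) /\
               is_derive (e q2) t (peval (Pmul crest2 crest2) (e p1 t) (e p2 t) (e k t)) /\
               flow_at (e p1) (e p2) (e k) t)).
  { clear; intros T q1 q2 p1 p2 (_ & _ & H) e k t Ht.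
    destruct (H t Ht) as (H1 & H2 & H3 & H4).
    assert (C1 := is_derive_on_continuous _ _ _ _ Ht H1).
    assert (C2 := is_derive_on_continuous _ _ _ _ Ht H2).
    assert (C3 := is_derive_on_continuous _ _ _ _ Ht H3).
    assert (C4 := is_derive_on_continuous _ _ _ _ Ht H4).
    split.
    - repeat split; try assumption. unfold e, k.
      apply continuous_exp_comp.
      apply (continuous_opp (K := R_AbsRing) (V := R_NormedModule)
        (fun s => q2 (Rmax 0 s) - q1 (Rmax 0 s))).
      now apply (continuous_minus (K := R_AbsRing) (V := R_NormedModule)
        (fun s => q2 (Rmax 0 s)) (fun s => q1 (Rmax 0 s))).
    - intros t0. assert (E : Rmax 0 t = t) by (apply Rmax_right; lra).
      assert (Ht' : 0 < t < T) by (split; [exact t0|apply Ht]).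
      apply (is_derive_on_interior T _ _ _ Ht') in H1, H2, H3, H4.
      unfold flow_at, e; rewrite E.
      refine (conj _ (conj _ (conj _ (conj _ _)))).
      + apply (is_derive_Rmax_0 q1 _ _ t0). evar_last; [exact H1|]. unfold k; simpl; ring.
      + apply (is_derive_Rmax_0 q2 _ _ t0). evar_last; [exact H2|]. unfold k; simpl; ring.
      + apply (is_derive_Rmax_0 p1 _ _ t0). evar_last; [exact H3|]. unfold k; simpl; ring.
      + apply (is_derive_Rmax_0 p2 _ _ t0). evar_last; [exact H4|]. unfold k; simpl; ring.
      + apply (is_derive_Rmax_0 k _ _ t0). evar_last.
        * apply (is_derive_comp exp (fun s => - (q2 s - q1 s))); [apply is_derive_exp|].
          apply (is_derive_opp (K := R_AbsRing) (V := R_NormedModule) (fun s => q2 s - q1 s)).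
          apply (is_derive_minus (K := R_AbsRing) (V := R_NormedModule) q2 q1); eassumption.
        * unfold k, scal, minus, plus, opp; simpl; unfold mult; simpl; ring. }
  intros Hp Hs t Ht Ht'.
  assert (EP := Ext _ _ _ _ _ Hp); assert (ES := Ext _ _ _ _ _ Hs); clear Ext.
  destruct Hp as (_ & (Ip1 & Ip2 & Ip3 & Ip4) & _); destruct Hs as (_ & (Is1 & Is2 & Is3 & Is4) & _).
  assert (t0 : 0 <= t) by apply Ht.
  assert (Lt : forall r, 0 <= r <= t -> lifespan T r) by (unfold lifespan in *; intros; lra).
  assert (Lt' : forall r, 0 <= r <= t -> lifespan T' r) by (unfold lifespan in *; intros; lra).
  set (e := fun (f : R -> R) s => f (Rmax 0 s)).
  set (k := fun s => exp (- (q2 s - q1 s))); set (l := fun s => exp (- (r2 s - r1 s))).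
  assert (E0 : Rmax 0 0 = 0) by (apply Rmax_right; lra).
  assert (U : forall r, 0 <= r <= t -> e p1 r = e s1 r /\ e p2 r = e s2 r /\ e k r = e l r).
  { intros r Hr; apply flow_unique; try lra.
    - intros z Hz; now apply EP, Lt; lra.
    - intros z Hz; now apply ES, Lt'; lra.
    - intros z Hz; now apply EP; [apply Lt; lra|].
    - intros z Hz; now apply ES; [apply Lt'; lra|].
    - unfold e; rewrite E0; congruence.
    - unfold e; rewrite E0; congruence.
    - unfold e, k, l; rewrite E0; congruence. }
  assert (Et : Rmax 0 t = t) by (apply Rmax_right; lra).
  assert (Q1 : e r1 t = e q1 t).
  { apply (eq_of_same_derive _ _ (fun r => peval (Pmul crest1 crest1) (e p1 r) (e p2 r) (e k r))); auto.
    - intros z Hz; now apply ES, Lt'.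
    - intros z Hz; now apply EP, Lt.
    - intros z Hz; destruct (U z) as (-> & -> & ->); [lra|]. apply ES; [apply Lt'|]; lra.
    - intros z Hz; apply EP; [apply Lt|]; lra.
    - unfold e; rewrite E0; congruence. }
  assert (Q2 : e r2 t = e q2 t).
  { apply (eq_of_same_derive _ _ (fun r => peval (Pmul crest2 crest2) (e p1 r) (e p2 r) (e k r))); auto.
    - intros z Hz; now apply ES, Lt'.
    - intros z Hz; now apply EP, Lt.
    - intros z Hz; destruct (U z) as (-> & -> & ->); [lra|]. apply ES; [apply Lt'|]; lra.
    - intros z Hz; apply EP; [apply Lt|]; lra.
    - unfold e; rewrite E0; congruence. }
  destruct (U t) as (U1 & U2 & _); [lra|].
  unfold e in *; rewrite Et in *; auto.
Qed.

Lemma smooth_on_peval (T : R) (p1 p2 k : R -> R) (e : flow_poly) :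
  (forall t, lifespan T t -> flow_at p1 p2 k t) ->
  smooth_on (lifespan T) (fun t => peval e (p1 t) (p2 t) (k t)).
Proof.
  intros H. exists (fun n t => peval (Nat.iter n pderive e) (p1 t) (p2 t) (k t)); split.
  - reflexivity.
  - intros n t Ht. apply is_derive_on_of_is_derive; [exact Ht|].
    apply (is_derive_peval p1 p2 k t (Nat.iter n pderive e)); auto.
Qed.

(** Serves the positions, which are not polynomials in the momenta and [exp (- q)], although their
    derivatives are. *)
Lemma smooth_on_derive (T : R) (f df : R -> R) :
  (forall t, lifespan T t -> is_derive f t (df t)) ->
  smooth_on (lifespan T) df -> smooth_on (lifespan T) f.
Proof.
  intros Hf [F [F0 HF]].
  exists (fun n => match n with O => f | S m => F m end); split; [reflexivity|].
  intros [|n] t Ht.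
  - rewrite F0 by exact Ht. apply is_derive_on_of_is_derive; auto.
  - apply HF, Ht.
Qed.

(** * The constants of motion and the reduced formulas *)

Lemma mom_p_sqr (A B x : R) : 0 < A -> 0 < B -> 0 < x < 1 -> mom_p A B x ^ 2 = A + B / x ^ 2.
Proof.
  intros HA HB Hx. unfold mom_p.
  replace ((sqrt (A * x ^ 2 + B) / x) ^ 2) with (sqrt (A * x ^ 2 + B) ^ 2 / x ^ 2) by (field; lra).
  rewrite sqrt_p_sqr by assumption. field; lra.
Qed.

(** As [- p1 <= p], one has [p2 p >= - p1 p2 >= B / (4 x ^ 2)], while
    [p ^ 2 = A + B / x ^ 2 <= (A + B) / x ^ 2] because [x < 1]. *)
Lemma mom2_lower (A B x : R) : 0 < A -> 0 < B -> 0 < x < 1 -> 0 < A - B * x ^ 2 ->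
  B / (4 * (A + B)) * mom_p A B x <= mom2 A B x.
Proof.
  intros HA HB Hx Hw.
  assert (P := mom_p_pos A B x HA HB Hx). assert (W := mom_w_neg A B x Hw).
  assert (P1 := mom1_neg A B x HA HB Hx Hw).
  assert (P2 := mom2_pos A B x HA HB Hx Hw).
  assert (Hm := mom_mult A B x HA HB Hx Hw). assert (Hp := mom_p_sqr A B x HA HB Hx).
  assert (x2 : 0 < x ^ 2) by (apply pow_lt; lra).
  assert (ix2 : 1 <= / x ^ 2).
  { rewrite <- Rinv_1 at 1. apply Rinv_le_contravar; [exact x2|]. nra. }
  assert (Hle : - mom1 A B x <= mom_p A B x) by (unfold mom1, mom2 in *; lra).
  set (p := mom_p A B x) in *; set (m1 := mom1 A B x) in *; set (m2 := mom2 A B x) in *.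
  apply Rmult_le_reg_r with p; [exact P|].
  apply Rle_trans with (m2 * - m1); [|apply Rmult_le_compat_l; lra].
  replace (m2 * - m1) with (B * (x ^ 2 + / x ^ 2) / 4) by lra.
  replace (B / (4 * (A + B)) * p * p) with (B / (4 * (A + B)) * p ^ 2) by ring.
  rewrite Hp. unfold Rdiv at 2. set (z := / x ^ 2) in *.
  apply Rle_trans with (B / (4 * (A + B)) * ((A + B) * z)).
  - apply Rmult_le_compat_l; [|nra].
    apply Rlt_le, Rdiv_lt_0_compat; lra.
  - replace (B / (4 * (A + B)) * ((A + B) * z)) with (B * z / 4) by (field; lra). nra.
Qed.

Lemma ln_le_sub_1 (z : R) : 0 < z -> ln z <= z - 1.
Proof.
  intros Hz. destruct (Req_dec z 1) as [->|Hne]; [rewrite ln_1; lra|].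
  assert (H := exp_ineq1 (ln z)). rewrite exp_ln in H by exact Hz.
  assert (ln z <> 0) by (intros E; apply Hne; rewrite <- (exp_ln z Hz), E; apply exp_0).
  specialize (H H0); lra.
Qed.

(** With [k = exp_neg_q x], use [1 - k <= - ln k <= / k - 1]. The bounds are [2 s / (1 + s)] and
    [2 s / (1 - s)] for [s = x ^ 4], and [s < 1]. *)
Lemma q_bounds (x x0 : R) : 0 < x <= x0 -> x0 < 1 ->
  x ^ 4 <= - ln (exp_neg_q x) <= 2 / (1 - x0 ^ 4) * x ^ 4.
Proof.
  intros Hx Hx0.
  assert (H := pow4_lt_1 x ltac:(lra)). assert (H0 := pow4_lt_1 x0 ltac:(lra)).
  assert (Hle : x ^ 4 <= x0 ^ 4) by (apply pow_incr; lra).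
  assert (Hk := exp_neg_q_bounds x ltac:(lra)).
  set (s := x ^ 4) in *; set (s0 := x0 ^ 4) in *.
  split.
  - assert (Hl := ln_le_sub_1 (exp_neg_q x) ltac:(lra)).
    apply Rle_trans with (1 - exp_neg_q x); [|lra].
    unfold exp_neg_q; fold s. replace (1 - (1 - s) / (1 + s)) with (2 * s / (1 + s)) by (field; lra).
    apply Rmult_le_reg_r with (1 + s); [lra|].
    replace (2 * s / (1 + s) * (1 + s)) with (2 * s) by (field; lra). nra.
  - rewrite <- ln_Rinv by lra.
    eapply Rle_trans; [apply ln_le_sub_1, Rinv_0_lt_compat; lra|].
    unfold exp_neg_q; fold s.
    replace (/ ((1 - s) / (1 + s)) - 1) with (2 * / (1 - s) * s) by (field; lra).
    apply Rmult_le_compat_r; [lra|]. apply Rmult_le_compat_l; [lra|].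
    apply Rinv_le_contravar; lra.
Qed.

Lemma Rpower_q_bounds (C x q : R) : 0 < C -> 0 < x -> x ^ 4 <= q <= C * x ^ 4 ->
  Rpower C (- (1 / 4)) / x <= Rpower q (- (1 / 4)) <= / x.
Proof.
  intros HC Hx Hq. assert (H4 : 0 < x ^ 4) by (apply pow_lt; lra).
  assert (E : / x = Rpower (x ^ 4) (- (1 / 4))).
  { rewrite <- (Rpower_pow 4 x Hx), Rpower_mult.
    replace (INR 4 * - (1 / 4)) with (Ropp 1) by (simpl; field).
    rewrite Rpower_Ropp, Rpower_1; auto. }
  assert (Anti : forall z w, 0 < z -> z <= w -> Rpower w (- (1 / 4)) <= Rpower z (- (1 / 4))).
  { intros z w Hz Hzw. unfold Rpower.
    assert (ln z <= ln w) by (apply ln_le; assumption).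
    destruct (Req_dec (ln z) (ln w)) as [->|]; [lra|]. left; apply exp_increasing; lra. }
  split.
  - unfold Rdiv at 1; rewrite E, Rpower_mult_distr by assumption. apply Anti; lra.
  - rewrite E. apply Anti; lra.
Qed.

Lemma sqrt_one_minus_exp_neg_q (x : R) : 0 <= x ->
  sqrt (1 - exp_neg_q x ^ 2) = 2 * x ^ 2 / (1 + x ^ 4).
Proof.
  intros Hx. assert (H := one_plus_pow4 x). assert (0 <= x ^ 2) by apply pow2_ge_0.
  apply sqrt_lem_1.
  - unfold exp_neg_q. replace (1 - ((1 - x ^ 4) / (1 + x ^ 4)) ^ 2)
      with (((2 * x ^ 2) / (1 + x ^ 4)) ^ 2) by (field; lra). apply pow2_ge_0.
  - apply Rdiv_le_0_compat; lra.
  - unfold exp_neg_q; field; lra.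
Qed.

(** * Initial data and reduced formulas in the variable [x] *)

Definition x_init (a : R) : R := sqrt (sqrt ((1 - exp (- (2 * a))) / (1 + exp (- (2 * a))))).
(** [x_init a] is the fourth root of [tanh a = tanh (q0 / 2)]. [coef_B] is solved from
    [p1 p2 = - b (b + delta)] at that point, and [coef_A] from [w ^ 2 = delta ^ 2] there. *)
Definition coef_B (a b delta : R) : R :=
  4 * b * (b + delta) * x_init a ^ 2 / (1 + x_init a ^ 4).
Definition coef_A (a b delta : R) : R := delta ^ 2 + coef_B a b delta * x_init a ^ 2.

Lemma exp_neg_bounds (a : R) : 0 < a -> 0 < exp (- (2 * a)) < 1.
Proof. intros; split; [apply exp_pos|]. rewrite <- exp_0; apply exp_increasing; lra. Qed.

Lemma x_init_pow4 (a : R) : 0 < a ->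
  x_init a ^ 4 = (1 - exp (- (2 * a))) / (1 + exp (- (2 * a))).
Proof.
  intros Ha; assert (He := exp_neg_bounds a Ha). unfold x_init.
  replace 4%nat with (2 * 2)%nat by reflexivity.
  assert (0 <= (1 - exp (- (2 * a))) / (1 + exp (- (2 * a)))) by (apply Rdiv_le_0_compat; lra).
  rewrite pow_mult, !pow2_sqrt; auto using sqrt_pos.
Qed.

Lemma x_init_bounds (a : R) : 0 < a -> 0 < x_init a < 1.
Proof.
  intros Ha; assert (He := exp_neg_bounds a Ha). unfold x_init; split.
  - repeat apply sqrt_lt_R0. apply Rdiv_lt_0_compat; lra.
  - assert (H : forall z, 0 <= z < 1 -> sqrt z < 1).
    { intros z Hz; replace 1 with (sqrt 1) by apply sqrt_1. now apply sqrt_lt_1_alt. }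
    apply H; split; [apply sqrt_pos|].
    apply H; split; [apply Rdiv_le_0_compat; lra|].
    apply (Rdiv_lt_1 (1 - exp (- (2 * a)))); lra.
Qed.

Lemma exp_neg_q_init (a : R) : 0 < a -> exp_neg_q (x_init a) = exp (- (2 * a)).
Proof.
  intros Ha; assert (He := exp_neg_bounds a Ha). unfold exp_neg_q.
  rewrite x_init_pow4 by exact Ha. field; lra.
Qed.

Lemma exp_neg_double (q : R) : exp (- 2 * q) = exp (- q) ^ 2.
Proof. simpl; rewrite Rmult_1_r, <- exp_plus; f_equal; ring. Qed.

Lemma coef_B_z1 (a b delta : R) : 0 < a -> 2 * z1 a b delta = coef_B a b delta.
Proof.
  intros Ha. unfold z1, coef_B.
  rewrite exp_neg_double, <- exp_neg_q_init by exact Ha.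
  assert (Hx := x_init_bounds a Ha). rewrite sqrt_one_minus_exp_neg_q by lra.
  assert (H := one_plus_pow4 (x_init a)). field; lra.
Qed.

(** Identifies [A] with [w_T ^ 2]: at the collision [x = 0] one has [w = - sqrt A]. *)
Lemma coef_A_alt (a b delta : R) : 0 < a ->
  coef_A a b delta = delta ^ 2 + 2 * b * (b + delta) * (1 - exp (- (2 * a))).
Proof.
  intros Ha; unfold coef_A, coef_B. rewrite <- exp_neg_q_init by exact Ha. unfold exp_neg_q.
  assert (H := one_plus_pow4 (x_init a)). field; lra.
Qed.

Lemma coef_pos (a b delta : R) : 0 < a -> 0 < b -> 0 < delta ->
  0 < coef_A a b delta /\ 0 < coef_B a b delta.
Proof.
  intros Ha Hb Hd. assert (Hx0 := x_init_bounds a Ha).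
  assert (H := one_plus_pow4 (x_init a)). assert (H2 : 0 < x_init a ^ 2) by (apply pow_lt; lra).
  assert (HB : 0 < coef_B a b delta).
  { apply Rdiv_lt_0_compat; [|exact H]. repeat apply Rmult_lt_0_compat; lra. }
  split; [|exact HB]. unfold coef_A. assert (0 < delta ^ 2) by (apply pow_lt; lra). nra.
Qed.

(** The quotient [(1 + exp (- q)) / sqrt (1 - exp (- 2 * q))] is [/ x ^ 2], so the radicand is
    [p0 ^ 2 + B (/ x ^ 2 - / x0 ^ 2)]. In the formula for [w] the inverse quotient gives [x ^ 2]. *)
Lemma p_formula_reduced (a b delta q x : R) : 0 < a -> 0 < b -> 0 < delta -> 0 < x < 1 ->
  exp (- q) = exp_neg_q x ->
  mom_p (coef_A a b delta) (coef_B a b delta) x = p_formula a b delta q.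
Proof.
  intros Ha Hb Hd Hx Hq. destruct (coef_pos a b delta Ha Hb Hd) as [HA HB].
  rewrite <- (sqrt_pow2 (mom_p _ _ x)) by (left; apply mom_p_pos; assumption).
  rewrite mom_p_sqr by assumption. unfold p_formula. f_equal.
  rewrite coef_B_z1, !exp_neg_double, Hq, <- exp_neg_q_init by exact Ha.
  assert (Hx0 := x_init_bounds a Ha). rewrite !sqrt_one_minus_exp_neg_q by lra.
  assert (H := one_plus_pow4 (x_init a)). assert (H1 := one_plus_pow4 x).
  unfold coef_A, coef_B, exp_neg_q. field; lra.
Qed.

Lemma w_formula_reduced (a b delta q x : R) : 0 < a -> 0 < x < 1 ->
  exp (- q) = exp_neg_q x ->
  mom_w (coef_A a b delta) (coef_B a b delta) x = w_formula a b delta q.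
Proof.
  intros Ha Hx Hq. unfold w_formula, mom_w. do 2 f_equal.
  rewrite coef_B_z1, !exp_neg_double, Hq, <- exp_neg_q_init by exact Ha.
  assert (Hx0 := x_init_bounds a Ha). rewrite !sqrt_one_minus_exp_neg_q by lra.
  assert (H := one_plus_pow4 (x_init a)). assert (H1 := one_plus_pow4 x).
  unfold coef_A, coef_B, exp_neg_q. field; lra.
Qed.

Lemma mom_init (a b delta : R) : 0 < a -> 0 < b -> 0 < delta ->
  mom1 (coef_A a b delta) (coef_B a b delta) (x_init a) = - b - delta /\
  mom2 (coef_A a b delta) (coef_B a b delta) (x_init a) = b.
Proof.
  intros Ha Hb Hd. destruct (coef_pos a b delta Ha Hb Hd) as [HA HB].
  assert (Hx0 := x_init_bounds a Ha). assert (H := one_plus_pow4 (x_init a)).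
  assert (P : mom_p (coef_A a b delta) (coef_B a b delta) (x_init a) = 2 * b + delta).
  { rewrite <- (sqrt_pow2 (mom_p _ _ _)) by (left; apply mom_p_pos; assumption).
    rewrite mom_p_sqr by assumption. rewrite <- (sqrt_pow2 (2 * b + delta)) by lra.
    f_equal. unfold coef_A, coef_B. field; lra. }
  assert (W : mom_w (coef_A a b delta) (coef_B a b delta) (x_init a) = - delta).
  { unfold mom_w, coef_A.
    match goal with |- - sqrt ?z = _ => replace z with (delta ^ 2) by ring end.
    rewrite sqrt_pow2; lra. }
  unfold mom1, mom2; rewrite P, W; lra.
Qed.

(** Three lower bounds are multiplied: [sqrt (A x ^ 2 + B) >= sqrt B], at least
    [sqrt (2 b (b + delta)) x0] because [1 + x0 ^ 4 < 2]; [sqrt (A - B x ^ 2) >= delta] because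
    [x <= x0]; and [exp_neg_q x >= / 2]. The last one and the factor [/ 2] of [speed] give the [4].
    The factor [x0] is kept, to cancel against the distance to travel. *)
Lemma speed_bounds (a b delta x : R) : 0 < a <= 1 / 4 -> 0 < b -> 0 < delta ->
  0 <= x <= x_init a ->
  sqrt (2 * b * (b + delta)) * x_init a * delta / 4
    <= speed (coef_A a b delta) (coef_B a b delta) x
    <= sqrt (coef_A a b delta + coef_B a b delta) * sqrt (coef_A a b delta).
Proof.
  intros [Ha Ha4] Hb Hd Hx. destruct (coef_pos a b delta Ha Hb Hd) as [HA HB].
  assert (Hx0 := x_init_bounds a Ha). assert (H := one_plus_pow4 (x_init a)).
  assert (Hx2 : x ^ 2 <= x_init a ^ 2) by (apply pow_incr; lra).
  assert (x2 : 0 <= x ^ 2) by apply pow2_ge_0.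
  assert (x02 : x_init a ^ 2 <= 1) by (rewrite <- (pow1 2); apply pow_incr; lra).
  assert (Hx4 : x ^ 4 <= x_init a ^ 4) by (apply pow_incr; lra).
  assert (x4 : 0 <= x ^ 4) by (apply pow_le; lra).
  assert (Hk : / 2 <= exp_neg_q x <= 1).
  { assert (He : / 2 <= exp_neg_q (x_init a)).
    (* Here [a <= 1 / 4] enters: [exp (- 2 a) > 1 - 2 a >= / 2]. *)
    { rewrite exp_neg_q_init by exact Ha. assert (E := exp_ineq1 (- (2 * a)) ltac:(lra)). lra. }
    split.
    - apply Rle_trans with (1 := He). unfold exp_neg_q, Rdiv.
      assert (x_init a ^ 4 < 1) by (apply pow4_lt_1; lra).
      apply Rmult_le_compat; try lra.
      + left; apply Rinv_0_lt_compat; lra.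
      + apply Rinv_le_contravar; lra.
    - unfold exp_neg_q. apply Rmult_le_reg_r with (1 + x ^ 4); [lra|].
      unfold Rdiv; rewrite Rmult_assoc, Rinv_l by lra. lra. }
  assert (S1 : sqrt (2 * b * (b + delta)) * x_init a <= sqrt (coef_A a b delta * x ^ 2 + coef_B a b delta)).
  { rewrite <- (sqrt_pow2 (x_init a)) at 1 by lra.
    rewrite <- sqrt_mult_alt by (repeat apply Rmult_le_pos; lra).
    apply sqrt_le_1_alt. apply Rle_trans with (coef_B a b delta); [|nra].
    unfold coef_B. apply Rmult_le_reg_r with (1 + x_init a ^ 4); [exact H|].
    replace (4 * b * (b + delta) * x_init a ^ 2 / (1 + x_init a ^ 4) * (1 + x_init a ^ 4))
      with (4 * b * (b + delta) * x_init a ^ 2) by (field; lra).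
    assert (x_init a ^ 4 < 1) by (apply pow4_lt_1; lra).
    assert (0 < b * (b + delta)) by (apply Rmult_lt_0_compat; lra).
    assert (0 < x_init a ^ 2) by (apply pow_lt; lra).
    assert (0 < b * (b + delta) * x_init a ^ 2) by (apply Rmult_lt_0_compat; lra).
    nra. }
  assert (S2 : sqrt (coef_A a b delta * x ^ 2 + coef_B a b delta)
               <= sqrt (coef_A a b delta + coef_B a b delta)) by (apply sqrt_le_1_alt; nra).
  assert (V1 : delta <= sqrt (coef_A a b delta - coef_B a b delta * x ^ 2)).
  { rewrite <- (sqrt_pow2 delta) at 1 by lra. apply sqrt_le_1_alt. unfold coef_A at 1. nra. }
  assert (V2 : sqrt (coef_A a b delta - coef_B a b delta * x ^ 2) <= sqrt (coef_A a b delta))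
    by (apply sqrt_le_1_alt; nra).
  unfold speed.
  set (s := sqrt (coef_A a b delta * x ^ 2 + coef_B a b delta)) in *.
  set (v := sqrt (coef_A a b delta - coef_B a b delta * x ^ 2)) in *.
  set (k := exp_neg_q x) in *.
  set (s0 := sqrt (2 * b * (b + delta)) * x_init a) in *.
  assert (s0p : 0 <= s0) by (apply Rmult_le_pos; [apply sqrt_pos|lra]).
  assert (L : s0 * delta <= s * v) by (apply Rmult_le_compat; lra).
  assert (U : s * v <= sqrt (coef_A a b delta + coef_B a b delta) * sqrt (coef_A a b delta))
    by (apply Rmult_le_compat; lra).
  assert (0 <= s0 * delta) by (apply Rmult_le_pos; lra).
  split.
  - apply Rle_trans with (/ 2 * (s * v) * / 2); [lra|].
    replace (/ 2 * s * v * k) with (/ 2 * (s * v) * k) by ring.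
    apply Rmult_le_compat_l; lra.
  - apply Rle_trans with (s * v * 1); [|lra].
    replace (/ 2 * s * v * k) with (s * v * (/ 2 * k)) by ring.
    apply Rmult_le_compat_l; lra.
Qed.

(** * Continuity of the reduced quantities *)

Lemma continuous_sqrt_R (f : R -> R) (x : R) :
  continuous f x -> continuous (fun y => sqrt (f y)) x.
Proof. intros; apply (continuous_comp f sqrt); [assumption|apply continuous_sqrt]. Qed.

Lemma continuous_exp_neg_q (x : R) : continuous exp_neg_q x.
Proof. apply ex_derive_continuous_R; eexists; apply is_derive_exp_neg_q. Qed.

Lemma continuous_sqrt_p (A B x : R) : continuous (fun x => sqrt (A * x ^ 2 + B)) x.
Proof.
  apply continuous_sqrt_R, ex_derive_continuous_R. auto_derive; exact I.
Qed.

Lemma continuous_mom_w (A B x : R) : continuous (mom_w A B) x.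
Proof.
  apply (continuous_opp (K := R_AbsRing) (V := R_NormedModule) (fun x => sqrt (A - B * x ^ 2))).
  apply continuous_sqrt_R, ex_derive_continuous_R. auto_derive; exact I.
Qed.

Lemma continuous_mom_p (A B x : R) : x <> 0 -> continuous (mom_p A B) x.
Proof.
  intros Hx. apply (continuous_mult (K := R_AbsRing) (fun x => sqrt (A * x ^ 2 + B)) Rinv).
  - apply continuous_sqrt_p.
  - apply continuous_Rinv, Hx.
Qed.

Lemma continuous_speed (A B x : R) : continuous (speed A B) x.
Proof.
  apply (continuous_ext (fun x => - / 2 * sqrt (A * x ^ 2 + B) * mom_w A B x * exp_neg_q x)).
  { intros z; unfold speed, mom_w; real_ring. }
  apply (continuous_mult (K := R_AbsRing)
    (fun x => - / 2 * sqrt (A * x ^ 2 + B) * mom_w A B x) exp_neg_q);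
    [|apply continuous_exp_neg_q].
  apply (continuous_mult (K := R_AbsRing)
    (fun x => - / 2 * sqrt (A * x ^ 2 + B)) (mom_w A B)); [|apply continuous_mom_w].
  apply (continuous_mult (K := R_AbsRing)); [apply continuous_const|apply continuous_sqrt_p].
Qed.

(** * The solution *)

(** The derivative may vanish at the left end, where the crest value of [p2] can be zero; strict
    growth then comes from the right half of the interval. *)
Lemma increasing_of_derive_pos (f df : R -> R) (a b : R) : a < b ->
  (forall t, a <= t <= b -> is_derive f t (df t)) ->
  (forall t, a <= t <= b -> 0 <= df t) ->
  (forall t, a < t <= b -> 0 < df t) -> f a < f b.
Proof.
  intros ab Hf H0 H1.
  destruct (MVT_derive f df a ((a + b) / 2)) as [c [Hc E]]; [lra|intros; apply Hf; lra|].
  destruct (MVT_derive f df ((a + b) / 2) b) as [d [Hd F]]; [lra|intros; apply Hf; lra|].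
  assert (0 <= df c * ((a + b) / 2 - a)) by (apply Rmult_le_pos; [apply H0|]; lra).
  assert (0 < df d * (b - (a + b) / 2)) by (apply Rmult_lt_0_compat; [apply H1|]; lra).
  lra.
Qed.

Lemma decreasing_of_derive_neg (f df : R -> R) (a b : R) : a < b ->
  (forall t, a <= t <= b -> is_derive f t (df t)) ->
  (forall t, a <= t <= b -> df t < 0) -> f b < f a.
Proof.
  intros ab Hf Hd.
  destruct (MVT_derive f df a b) as [c [Hc E]]; [lra|assumption|].
  assert (df c < 0) by (apply Hd; lra). nra.
Qed.

Section Solution.

Variables a b delta T : R.
Variable y : R -> R.
Hypotheses (a_pos : 0 < a) (b_pos : 0 < b) (delta_pos : 0 < delta) (T_pos : 0 < T).

Let A := coef_A a b delta.
Let B := coef_B a b delta.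
Let x0 := x_init a.

Hypotheses (y_0 : y 0 = x0) (y_T : y T = 0) (y_cont : forall t, continuous y t)
  (y_decr : forall s t, s < t -> y t < y s)
  (y_derive : forall t, 0 <= t <= T -> is_derive y t (- speed A B (y t))).

Definition sol_p1 (t : R) : R := mom1 A B (y t).
Definition sol_p2 (t : R) : R := mom2 A B (y t).
Let p := fun t => mom_p A B (y t).
Let w := fun t => mom_w A B (y t).
Let k := fun t => exp_neg_q (y t).
Let v1 := fun t => (sol_p1 t + sol_p2 t * k t) ^ 2.
(** The reduced equation determines only the distance [q = - ln k]; [q1] is recovered by integrating
    its squared crest value, and [q2] is then [q1 + q]. *)
Definition sol_q1 (t : R) : R := - a + RInt v1 0 t.
Definition sol_q2 (t : R) : R := sol_q1 t - ln (k t).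

Lemma sol_A_pos : 0 < A. Proof. apply coef_pos; assumption. Qed.
Lemma sol_B_pos : 0 < B. Proof. apply coef_pos; assumption. Qed.

Lemma y_bounds (t : R) : lifespan T t -> 0 < y t <= x0 /\ x0 < 1.
Proof.
  intros [H0 H1]. split; [split|apply x_init_bounds; assumption].
  - rewrite <- y_T; now apply y_decr.
  - destruct H0 as [H0|<-]; [|lra]. rewrite <- y_0; left; now apply y_decr.
Qed.

Lemma y_lt_1 (t : R) : lifespan T t -> 0 < y t < 1.
Proof. intros Ht; generalize (y_bounds t Ht); lra. Qed.

(** By the choice of [A] the radicand is [delta ^ 2 + B (x0 ^ 2 - y t ^ 2)], so the asymmetry
    [delta] keeps [w] away from [0]. *)
Lemma w_arg_pos (t : R) : lifespan T t -> 0 < A - B * y t ^ 2.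
Proof.
  intros Ht; destruct (y_bounds t Ht) as [Hy _].
  assert (y t ^ 2 <= x0 ^ 2) by (apply pow_incr; lra).
  assert (0 < delta ^ 2) by (apply pow_lt; lra).
  assert (HB := sol_B_pos). unfold A, coef_A; fold B x0. nra.
Qed.

Local Hint Resolve sol_A_pos sol_B_pos y_lt_1 w_arg_pos : core.

Lemma y_derive_before_T (t : R) : lifespan T t -> is_derive y t (- speed A B (y t)).
Proof. intros [H1 H2]; apply y_derive; lra. Qed.

Local Hint Resolve y_derive_before_T : core.

Lemma k_bounds (t : R) : lifespan T t -> 0 < k t < 1.
Proof. intros; apply exp_neg_q_bounds; auto. Qed.

Lemma sol_p1_derive (t : R) : lifespan T t ->
  is_derive sol_p1 t (- sol_p1 t * sol_p2 t * (sol_p1 t + sol_p2 t * k t) * k t).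
Proof. intros; apply is_derive_mom1_t; auto. Qed.

Lemma sol_p2_derive (t : R) : lifespan T t ->
  is_derive sol_p2 t (sol_p1 t * sol_p2 t * (sol_p1 t * k t + sol_p2 t) * k t).
Proof. intros; apply is_derive_mom2_t; auto. Qed.

Lemma sol_k_derive (t : R) : lifespan T t ->
  is_derive k t (- k t * (sol_p2 t ^ 2 - sol_p1 t ^ 2) * (1 - k t ^ 2)).
Proof. intros; apply is_derive_k_t; auto. Qed.

(** Negative times are included, because differentiating the integral at [t = 0] takes a two-sided
    neighbourhood. *)
Lemma v1_continuous (t : R) : t < T -> continuous v1 t.
Proof.
  intros Ht. assert (Hy : y t <> 0) by (apply Rgt_not_eq; rewrite <- y_T; now apply y_decr).
  assert (Cp : continuous p t).
  { apply (continuous_comp y (mom_p A B)); [apply y_cont|now apply continuous_mom_p]. }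
  assert (Cw : continuous w t).
  { apply (continuous_comp y (mom_w A B)); [apply y_cont|apply continuous_mom_w]. }
  assert (Ck : continuous k t).
  { apply (continuous_comp y exp_neg_q); [apply y_cont|apply continuous_exp_neg_q]. }
  assert (Csq : forall z, continuous (fun z => z ^ 2) z).
  { intros z; apply ex_derive_continuous_R; auto_derive; exact I. }
  apply continuous_ext with (fun s =>
     (/ 2 * (w s + -1 * p s) + / 2 * (w s + p s) * k s) ^ 2).
  { intros s; unfold v1, sol_p1, sol_p2, mom1, mom2; fold (w s) (p s).
    match goal with |- @eq _ ?a ?b => change (@eq R a b) end. field. }
  apply (continuous_comp (fun s => / 2 * (w s + -1 * p s) + / 2 * (w s + p s) * k s) (fun z => z ^ 2)).
  - repeat (assumption || apply continuous_const || apply continuous_plus_R || apply continuous_mult_R).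
  - apply Csq.
Qed.

Lemma sol_q1_derive (t : R) : lifespan T t -> is_derive sol_q1 t (v1 t).
Proof.
  intros Ht. replace (v1 t) with (plus 0 (v1 t)) by (unfold plus; simpl; ring).
  apply (is_derive_plus (K := R_AbsRing) (V := R_NormedModule) (fun _ => - a) (fun t => RInt v1 0 t)).
  { apply (is_derive_const (K := R_AbsRing) (V := R_NormedModule)). }
  apply (is_derive_RInt (V := R_NormedModule) v1 (fun t => RInt v1 0 t) 0 t);
    [|apply v1_continuous, Ht].
  generalize (open_lt T t (proj2 Ht)); apply filter_imp; intros s Hs.
  apply (RInt_correct (V := R_CompleteNormedModule)).
  apply (ex_RInt_continuous (V := R_CompleteNormedModule)); intros z Hz.
  apply v1_continuous. destruct Hz as [_ Hz]. revert Hz; unfold Rmax; destruct (Rle_dec 0 s); lra.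
Qed.

Lemma sol_q_diff (t : R) : sol_q2 t - sol_q1 t = - ln (k t).
Proof. unfold sol_q2; ring. Qed.

Lemma sol_exp_q (t : R) : lifespan T t -> exp (- (sol_q2 t - sol_q1 t)) = k t.
Proof. intros Ht. rewrite sol_q_diff, Ropp_involutive. apply exp_ln, k_bounds, Ht. Qed.

Lemma sol_q2_derive (t : R) : lifespan T t ->
  is_derive sol_q2 t ((sol_p1 t * k t + sol_p2 t) ^ 2).
Proof.
  intros Ht. assert (Hk := k_bounds t Ht). evar_last.
  - apply (is_derive_minus (K := R_AbsRing) (V := R_NormedModule) sol_q1 (fun t => ln (k t))).
    + now apply sol_q1_derive.
    + apply (is_derive_comp ln k).
      * apply is_derive_Reals, derivable_pt_lim_ln, Hk.
      * now apply sol_k_derive.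
  - unfold minus, plus, opp, scal; simpl; unfold mult; simpl. unfold v1. field; lra.
Qed.

Lemma sol_smooth : smooth_solution a b delta T sol_q1 sol_q2 sol_p1 sol_p2.
Proof.
  assert (F : forall t, lifespan T t -> flow_at sol_p1 sol_p2 k t).
  { intros t Ht; split; [|split]; evar_last.
    - now apply sol_p1_derive.
    - simpl; ring.
    - now apply sol_p2_derive.
    - simpl; ring.
    - now apply sol_k_derive.
    - simpl; ring. }
  split; [|split].
  - repeat split.
    + apply smooth_on_derive with (fun t => peval (Pmul crest1 crest1) (sol_p1 t) (sol_p2 t) (k t)).
      * intros t Ht; evar_last; [now apply sol_q1_derive|]. unfold v1; simpl; ring.
      * now apply smooth_on_peval.
    + apply smooth_on_derive with (fun t => peval (Pmul crest2 crest2) (sol_p1 t) (sol_p2 t) (k t)).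
      * intros t Ht; evar_last; [now apply sol_q2_derive|]. simpl; ring.
      * now apply smooth_on_peval.
    + exact (smooth_on_peval T sol_p1 sol_p2 k Pmom1 F).
    + exact (smooth_on_peval T sol_p1 sol_p2 k Pmom2 F).
  - assert (R0 : RInt v1 0 0 = 0) by apply (RInt_point (V := R_CompleteNormedModule)).
    destruct (mom_init a b delta a_pos b_pos delta_pos) as [M1 M2].
    unfold sol_q2, sol_q1, sol_p1, sol_p2, k; rewrite R0, y_0.
    unfold x0; rewrite exp_neg_q_init, ln_exp by assumption.
    repeat split; try assumption; ring.
  - intros t Ht; cbv zeta; rewrite sol_exp_q by exact Ht.
    split; [|split; [|split]]; apply is_derive_on_of_is_derive; auto.
    + now apply sol_q1_derive.
    + now apply sol_q2_derive.
    + now apply sol_p1_derive.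
    + now apply sol_p2_derive.
Qed.

Lemma sol_p (t : R) : sol_p2 t - sol_p1 t = p t.
Proof. unfold sol_p1, sol_p2, mom1, mom2, p; field. Qed.
Lemma sol_w (t : R) : sol_p1 t + sol_p2 t = w t.
Proof. unfold sol_p1, sol_p2, mom1, mom2, w; field. Qed.

Lemma sol_q_pos (t : R) : lifespan T t -> 0 < sol_q2 t - sol_q1 t.
Proof.
  intros Ht; assert (Hk := k_bounds t Ht). rewrite sol_q_diff.
  assert (ln (k t) < ln 1) by (apply ln_increasing; lra). rewrite ln_1 in H; lra.
Qed.

(** * Limits and asymptotics at the collision *)

Lemma sol_at_left (f : R -> R) : continuous f 0 ->
  filterlim (fun t => f (y t)) (at_left T) (locally (f 0)).
Proof.
  intros Hf. rewrite <- y_T. rewrite <- y_T in Hf.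
  intros P HP; apply filter_le_within.
  exact (continuous_comp y f T (y_cont T) Hf P HP).
Qed.

Lemma sol_q_lim : filterlim (fun t => sol_q2 t - sol_q1 t) (at_left T) (locally 0).
Proof.
  assert (E0 : exp_neg_q 0 = 1) by (unfold exp_neg_q; field).
  replace 0 with (- ln (exp_neg_q 0)) by (rewrite E0, ln_1; ring).
  apply filterlim_ext with (fun t => - ln (exp_neg_q (y t))).
  { intros t; now rewrite sol_q_diff. }
  apply (sol_at_left (fun x => - ln (exp_neg_q x))).
  apply (continuous_opp (K := R_AbsRing) (V := R_NormedModule) (fun x => ln (exp_neg_q x))).
  apply (continuous_comp exp_neg_q ln); [apply continuous_exp_neg_q|].
  apply continuous_ln; rewrite E0; lra.
Qed.

Lemma sol_w_lim : filterlim (fun t => sol_p1 t + sol_p2 t) (at_left T) (locally (- sqrt A)).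
Proof.
  replace (- sqrt A) with (mom_w A B 0).
  - apply filterlim_ext with (fun t => mom_w A B (y t)).
    { intros t; now rewrite sol_w. }
    apply sol_at_left, continuous_mom_w.
  - unfold mom_w; do 2 f_equal; ring.
Qed.

Lemma at_left_lifespan : at_left T (lifespan T).
Proof.
  exists (mkposreal T T_pos); intros t Ht HtT. split; [|exact HtT].
  unfold ball in Ht; simpl in Ht; unfold AbsRing_ball, abs, minus, plus, opp in Ht; simpl in Ht.
  apply Rabs_lt_between in Ht; lra.
Qed.

Lemma sol_p_lower (t : R) : lifespan T t -> sqrt B / y t <= p t.
Proof.
  intros Ht; assert (Hy := y_lt_1 t Ht). unfold p, mom_p, Rdiv.
  apply Rmult_le_compat_r; [left; apply Rinv_0_lt_compat; lra|].
  apply sqrt_le_1_alt. assert (HA := sol_A_pos). assert (0 <= y t ^ 2) by apply pow2_ge_0. nra.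
Qed.

Lemma sol_p_upper (t : R) : lifespan T t -> p t <= sqrt (A + B) / y t.
Proof.
  intros Ht; assert (Hy := y_lt_1 t Ht). unfold p, mom_p, Rdiv.
  apply Rmult_le_compat_r; [left; apply Rinv_0_lt_compat; lra|].
  apply sqrt_le_1_alt. assert (HA := sol_A_pos). assert (y t ^ 2 <= 1) by nra. nra.
Qed.

Lemma sol_p_lim (M : R) : at_left T (fun t => M < p t).
Proof.
  assert (HB : 0 < sqrt B) by (apply sqrt_lt_R0; auto).
  assert (Hp : 0 < sqrt B / (Rabs M + 1)) by (apply Rdiv_lt_0_compat; [|generalize (Rabs_pos M)]; lra).
  assert (Hy := sol_at_left (fun x => x) (continuous_id 0) _ (open_lt _ 0 Hp)).
  unfold filtermap in Hy. generalize (filter_and _ _ Hy at_left_lifespan).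
  apply filter_imp; intros t [H1 H2].
  assert (H := sol_p_lower t H2). assert (Hyt := y_lt_1 t H2).
  assert (HM := Rabs_pos M). assert (HM' := Rle_abs M).
  assert (H3 : Rabs M + 1 < sqrt B / y t).
  { apply Rmult_lt_reg_r with (y t / (Rabs M + 1)); [apply Rdiv_lt_0_compat; lra|].
    replace ((Rabs M + 1) * (y t / (Rabs M + 1))) with (y t) by (field; lra).
    replace (sqrt B / y t * (y t / (Rabs M + 1))) with (sqrt B / (Rabs M + 1)) by (field; lra).
    exact H1. }
  lra.
Qed.

Lemma sol_p1_neg (t : R) : lifespan T t -> sol_p1 t < 0.
Proof. intros; apply mom1_neg; auto. Qed.
Lemma sol_p2_pos (t : R) : lifespan T t -> 0 < sol_p2 t.
Proof. intros; apply mom2_pos; auto. Qed.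
Lemma sol_p_pos (t : R) : lifespan T t -> 0 < p t.
Proof. intros; apply mom_p_pos; auto. Qed.
Lemma sol_w_neg (t : R) : lifespan T t -> w t < 0.
Proof. intros; apply mom_w_neg; auto. Qed.

Lemma sol_p2_lower (t : R) : lifespan T t -> B / (4 * (A + B)) * p t <= sol_p2 t.
Proof. intros; apply mom2_lower; auto. Qed.

Lemma sol_p1_lim : filterlim sol_p1 (at_left T) (Rbar_locally m_infty).
Proof.
  intros P [M HM]. unfold filtermap.
  generalize (filter_and _ _ (sol_p_lim (- 2 * M)) at_left_lifespan).
  apply filter_imp; intros t [H1 H2]; apply HM.
  assert (Hw := sol_w_neg t H2). generalize (sol_p t) (sol_w t); lra.
Qed.

Lemma sol_p2_lim : filterlim sol_p2 (at_left T) (Rbar_locally p_infty).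
Proof.
  assert (HA := sol_A_pos). assert (HB := sol_B_pos).
  assert (Hc : 0 < B / (4 * (A + B))) by (apply Rdiv_lt_0_compat; lra).
  intros P [M HM]. unfold filtermap.
  generalize (filter_and _ _ (sol_p_lim (M / (B / (4 * (A + B))))) at_left_lifespan).
  apply filter_imp; intros t [H1 H2]; apply HM.
  assert (H := sol_p2_lower t H2). eapply Rlt_le_trans; [|exact H].
  set (c := B / (4 * (A + B))) in *.
  replace M with (c * (M / c)) by (field; lra). now apply Rmult_lt_compat_l.
Qed.

Lemma sol_p1_equivalent : equivalent_on (lifespan T) (fun t => - sol_p1 t) p.
Proof.
  (* [- p1 = (p - w) / 2] exceeds [p / 2] as [w < 0], and [- p1 = p - p2 < p]. *)
  exists (/ 2), 1; split; [lra|split; [lra|]]; intros t Ht.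
  generalize (sol_p t) (sol_w t) (sol_p2_pos t Ht) (sol_w_neg t Ht); lra.
Qed.

Lemma sol_p2_equivalent : equivalent_on (lifespan T) sol_p2 p.
Proof.
  assert (HA := sol_A_pos). assert (HB := sol_B_pos).
  exists (B / (4 * (A + B))), 1; split; [apply Rdiv_lt_0_compat; lra|split; [lra|]].
  intros t Ht; split; [now apply sol_p2_lower|].
  generalize (sol_p t) (sol_w t) (sol_p1_neg t Ht); lra.
Qed.

(** [p x] lies between [sqrt B] and [sqrt (A + B)], while [q] lies between [x ^ 4] and [C x ^ 4]. *)
Lemma sol_p_equivalent : equivalent_on (lifespan T) p
  (fun t => Rpower (sol_q2 t - sol_q1 t) (- (1 / 4))).
Proof.
  assert (HA := sol_A_pos). assert (HB := sol_B_pos).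
  assert (Hx0 := x_init_bounds a a_pos). fold x0 in Hx0. assert (H4 := pow4_lt_1 x0 Hx0).
  set (C := 2 / (1 - x0 ^ 4)).
  assert (HC : 0 < C) by (apply Rdiv_lt_0_compat; lra).
  assert (HR : 0 < Rpower C (- (1 / 4))) by apply exp_pos.
  exists (sqrt B), (sqrt (A + B) / Rpower C (- (1 / 4))).
  split; [apply sqrt_lt_R0; lra|split; [apply Rdiv_lt_0_compat; [apply sqrt_lt_R0; lra|exact HR]|]].
  intros t Ht; destruct (y_bounds t Ht) as [Hy _].
  assert (Hq := q_bounds (y t) x0 Hy ltac:(lra)).
  destruct (Rpower_q_bounds C (y t) _ HC ltac:(lra) Hq) as [R1 R2].
  rewrite sol_q_diff. fold (k t) in R1, R2. split.
  - eapply Rle_trans; [|apply sol_p_lower, Ht].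
    apply Rmult_le_compat_l; [apply sqrt_pos|exact R2].
  - eapply Rle_trans; [apply sol_p_upper, Ht|].
    set (c := Rpower C (- (1 / 4))) in *.
    replace (sqrt (A + B) / y t) with (sqrt (A + B) / c * (c / y t)) by (field; lra).
    apply Rmult_le_compat_l; [|exact R1].
    apply Rdiv_le_0_compat; [apply sqrt_pos|exact HR].
Qed.

(** In contrast to [q2], the crest value at [q1] is below [w] and hence negative at all times. *)
Lemma sol_p1_decreasing : decreasing_on (lifespan T) sol_p1.
Proof.
  intros s t Hs Ht st. eapply decreasing_of_derive_neg; [exact st|..].
  - intros r Hr; apply sol_p1_derive. unfold lifespan in *; lra.
  - intros r Hr; cbv beta. assert (Hr' : lifespan T r) by (unfold lifespan in *; lra).
    assert (K := k_bounds r Hr').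
    assert (H1 : sol_p1 r * sol_p2 r < 0) by (apply mom_mult_neg; auto).
    assert (H2 : sol_p1 r + sol_p2 r * k r < 0) by (apply mom_crest1_neg; auto).
    assert (0 < sol_p1 r * sol_p2 r * (sol_p1 r + sol_p2 r * k r)) by nra. nra.
Qed.

Lemma sol_w_decreasing : decreasing_on (lifespan T) w.
Proof.
  intros s t Hs Ht st. eapply decreasing_of_derive_neg; [exact st|..].
  - intros r Hr; apply is_derive_w_t; auto;
      try apply y_lt_1; try apply w_arg_pos; try apply y_derive_before_T; unfold lifespan in *; lra.
  - intros r Hr; cbv beta. assert (Hr' : lifespan T r) by (unfold lifespan in *; lra).
    assert (K := k_bounds r Hr').
    assert (H1 : sol_p1 r * sol_p2 r < 0) by (apply mom_mult_neg; auto).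
    assert (P := sol_p_pos r Hr').
    fold (sol_p1 r) (sol_p2 r) (p r) (k r).
    assert (0 < p r * k r) by nra. assert (0 < p r * k r * (1 - k r)) by nra. nra.
Qed.

(* [p2] increases where the crest value [p1 e^{-q} + p2] is negative; by [mom_crest2]
   this is [x ^ 3 sqrt (A x ^ 2 + B) < sqrt (A - B x ^ 2)], a condition that
   persists as [x] decreases. *)
Lemma sol_crest2_persists (t0 t : R) : lifespan T t0 -> lifespan T t -> t0 < t ->
  sol_p1 t0 * k t0 + sol_p2 t0 <= 0 -> sol_p1 t * k t + sol_p2 t < 0.
Proof.
  intros H0 Ht lt. unfold sol_p1, sol_p2, k.
  rewrite !mom_crest2 by auto.
  assert (Y0 := y_lt_1 t0 H0). assert (Y := y_lt_1 t Ht). assert (Hy := y_decr t0 t lt).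
  assert (HA := sol_A_pos). assert (HB := sol_B_pos).
  assert (D0 := one_plus_pow4 (y t0)). assert (D := one_plus_pow4 (y t)).
  intros H.
  assert (H' : y t0 ^ 3 * sqrt (A * y t0 ^ 2 + B) - sqrt (A - B * y t0 ^ 2) <= 0).
  { apply Rmult_le_reg_r with (/ (1 + y t0 ^ 4)); [now apply Rinv_0_lt_compat|].
    rewrite Rmult_0_l; exact H. }
  assert (Y2 : y t ^ 2 < y t0 ^ 2) by nra.
  assert (Y3 : y t ^ 3 < y t0 ^ 3) by (simpl; nra).
  assert (S : sqrt (A * y t ^ 2 + B) <= sqrt (A * y t0 ^ 2 + B)) by (apply sqrt_le_1_alt; nra).
  assert (S0 : 0 < sqrt (A * y t ^ 2 + B)) by (apply (sqrt_p_pos A B (y t)); auto).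
  assert (V : sqrt (A - B * y t0 ^ 2) <= sqrt (A - B * y t ^ 2)) by (apply sqrt_le_1_alt; nra).
  assert (Y3p : 0 < y t ^ 3) by (apply pow_lt; lra).
  assert (y t ^ 3 * sqrt (A * y t ^ 2 + B) < y t0 ^ 3 * sqrt (A * y t0 ^ 2 + B)) by nra.
  apply Rmult_lt_reg_r with (1 + y t ^ 4); [exact D|].
  unfold Rdiv; rewrite Rmult_assoc, Rinv_l by lra. lra.
Qed.

(** The condition on [b] says that the crest value at [q2] is nonpositive at time [0]. Otherwise it
    becomes negative close to [T], and any time at which it is negative serves as [t0]. *)
Lemma sol_p2_increasing : exists t0, lifespan T t0 /\
  (b <= (b + delta) * exp (- 2 * a) -> t0 = 0) /\
  increasing_on (fun t => t0 <= t < T) sol_p2.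
Proof.
  assert (Inc : forall t0, lifespan T t0 -> sol_p1 t0 * k t0 + sol_p2 t0 <= 0 ->
            increasing_on (fun t => t0 <= t < T) sol_p2).
  { intros t0 H0 Hc s t Hs Ht st.
    assert (L : forall r, t0 <= r < T -> lifespan T r) by (unfold lifespan in *; intros; lra).
    assert (Neg : forall r, t0 <= r < T -> sol_p1 r * k r + sol_p2 r <= 0 /\
                    (t0 < r -> sol_p1 r * k r + sol_p2 r < 0)).
    { intros r Hr; split.
      - destruct (Rle_lt_or_eq_dec t0 r (proj1 Hr)) as [Hlt|<-]; [|exact Hc].
        left; apply sol_crest2_persists with t0; auto.
      - intros Hlt; apply sol_crest2_persists with t0; auto. }
    eapply increasing_of_derive_pos; [exact st|..].
    - intros r Hr; apply sol_p2_derive, L; lra.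
    - intros r Hr; cbv beta. assert (Hr' : t0 <= r < T) by lra.
      assert (K := k_bounds r (L r Hr')).
      assert (H1 : sol_p1 r * sol_p2 r < 0) by (apply mom_mult_neg; auto).
      destruct (Neg r Hr') as [N _].
      assert (0 <= sol_p1 r * sol_p2 r * (sol_p1 r * k r + sol_p2 r)) by nra. nra.
    - intros r Hr; cbv beta. assert (Hr' : t0 <= r < T) by lra.
      assert (K := k_bounds r (L r Hr')).
      assert (H1 : sol_p1 r * sol_p2 r < 0) by (apply mom_mult_neg; auto).
      destruct (Neg r Hr') as [_ N]. specialize (N ltac:(lra)).
      assert (0 < sol_p1 r * sol_p2 r * (sol_p1 r * k r + sol_p2 r)) by nra. nra. }
  destruct (Rle_dec b ((b + delta) * exp (- 2 * a))) as [Hb|Hb].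
  - exists 0. assert (L0 : lifespan T 0) by (split; lra).
    split; [exact L0|split; [reflexivity|]]. apply Inc; [exact L0|].
    destruct (mom_init a b delta a_pos b_pos delta_pos) as [M1 M2].
    unfold sol_p1, sol_p2, k; rewrite y_0. unfold A, B, x0.
    rewrite M1, M2, exp_neg_q_init by assumption.
    replace (- (2 * a)) with (- 2 * a) by ring. lra.
  - assert (HA : 0 < sqrt A) by (apply sqrt_lt_R0; auto).
    (* This function of [x] is the numerator in [mom_crest2]; at [x = 0] it equals
       [- sqrt A < 0]. *)
    assert (Lim := sol_at_left (fun x => x ^ 3 * sqrt (A * x ^ 2 + B) + mom_w A B x)).
    assert (Hlt : 0 ^ 3 * sqrt (A * 0 ^ 2 + B) + mom_w A B 0 < 0).
    { unfold mom_w. replace (A - B * 0 ^ 2) with A by ring.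
      replace (0 ^ 3) with 0 by ring. lra. }
    assert (Ev := Lim ltac:(apply continuous_plus_R;
        [apply continuous_mult_R; [apply ex_derive_continuous_R; auto_derive; exact I
                                  |apply continuous_sqrt_p]
        |apply continuous_mom_w]) _ (open_lt _ _ Hlt)).
    unfold filtermap in Ev.
    destruct (filter_ex _ (filter_and _ _ Ev at_left_lifespan)) as [t0 [H1 H2]].
    exists t0; split; [exact H2|split; [intros; lra|]]. apply Inc; [exact H2|].
    unfold sol_p1, sol_p2, k; rewrite mom_crest2 by auto. left.
    assert (D := one_plus_pow4 (y t0)).
    apply Rmult_lt_reg_r with (1 + y t0 ^ 4); [exact D|].
    unfold Rdiv; rewrite Rmult_assoc, Rinv_l by lra. unfold mom_w in H1. lra.
Qed.

Lemma sol_novikov : novikov_solution T (two_peakon sol_q1 sol_q2 sol_p1 sol_p2).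
Proof.
  assert (L : forall t, 0 < t < T -> lifespan T t) by (unfold lifespan; intros; lra).
  apply two_peakon_novikov.
  - intros t Ht; generalize (sol_q_pos t (L t Ht)); lra.
  - intros t Ht. assert (Hl := L t Ht).
    replace (exp (sol_q1 t - sol_q2 t)) with (k t)
      by (rewrite <- sol_exp_q by exact Hl; f_equal; ring).
    split; [|split; [|split]].
    + now apply sol_q1_derive.
    + now apply sol_q2_derive.
    + now apply sol_p1_derive.
    + now apply sol_p2_derive.
Qed.

Lemma sol_maximal (T' : R) (r1 r2 s1 s2 : R -> R) : 0 < T' ->
  smooth_solution a b delta T' r1 r2 s1 s2 -> T' <= T.
Proof.
  intros HT' Hs. destruct (Rle_lt_dec T' T) as [H|H]; [exact H|exfalso].
  (* [T] would be interior to the longer lifespan, so [s2] would be continuous and bounded near [T],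
     although it coincides with [p2] on the left. *)
  assert (Ht : lifespan T' T) by (split; lra).
  destruct Hs as (S1 & S2 & S3). destruct (S3 T Ht) as (_ & _ & _ & D).
  apply is_derive_on_interior in D; [|lra].
  assert (C : continuous s2 T) by (apply ex_derive_continuous_R; eexists; exact D).
  assert (E1 : at_left T (fun t => s2 t < s2 T + 1)).
  { apply filter_le_within. apply (C (fun z => z < s2 T + 1)), open_lt; lra. }
  assert (E2 : at_left T (fun t => s2 T + 1 < sol_p2 t)).
  { apply (sol_p2_lim (fun z => s2 T + 1 < z)). now exists (s2 T + 1). }
  destruct (filter_ex _ (filter_and _ _ at_left_lifespan (filter_and _ _ E1 E2)))
    as [t [Hl [H1 H2]]].
  assert (U := smooth_solution_unique a b delta T T' _ _ _ _ r1 r2 s1 s2 sol_smooth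
    (conj S1 (conj S2 S3)) t Hl ltac:(unfold lifespan in *; lra)).
  lra.
Qed.

End Solution.

Theorem theorem3 :
  exists C b0 : R, 0 < C /\ 0 < b0 /\
  forall a b delta : R, 0 < a <= 1 / 4 -> b0 <= b -> 0 < delta ->
  exists (T : R) (q1 q2 p1 p2 : R -> R),
    let q := fun t => q2 t - q1 t in
    let p := fun t => p2 t - p1 t in
    let w := fun t => p1 t + p2 t in
    let wT := - sqrt (delta ^ 2 + 2 * b * (b + delta) * (1 - exp (- 2 * a))) in
    let u := two_peakon q1 q2 p1 p2 in
    0 < T /\
    smooth_solution a b delta T q1 q2 p1 p2 /\
    (forall (T' : R) (r1 r2 s1 s2 : R -> R),
       0 < T' -> smooth_solution a b delta T' r1 r2 s1 s2 ->
       T' <= T /\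
       forall t, lifespan T' t ->
         r1 t = q1 t /\ r2 t = q2 t /\ s1 t = p1 t /\ s2 t = p2 t) /\
    ((forall t, lifespan T t -> 0 < q t) /\
     filterlim q (at_left T) (locally 0)) /\
    T <= C * (1 / (delta * sqrt (2 * b * (b + delta)))) /\
    (forall t, lifespan T t ->
       p t = p_formula a b delta (q t) /\ w t = w_formula a b delta (q t)) /\
    ((forall t, lifespan T t -> p1 t = (w t - p t) / 2 /\ p1 t < 0) /\
     decreasing_on (lifespan T) p1 /\
     filterlim p1 (at_left T) (Rbar_locally m_infty) /\
     equivalent_on (lifespan T) (fun t => - p1 t) p /\
     equivalent_on (lifespan T) p (fun t => Rpower (q t) (- (1 / 4)))) /\
    ((forall t, lifespan T t -> p2 t = (w t + p t) / 2 /\ 0 < p2 t) /\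
     (exists t0, lifespan T t0 /\
        (b <= (b + delta) * exp (- 2 * a) -> t0 = 0) /\
        increasing_on (fun t => t0 <= t < T) p2) /\
     filterlim p2 (at_left T) (Rbar_locally p_infty) /\
     equivalent_on (lifespan T) p2 p) /\
    (decreasing_on (lifespan T) w /\ w 0 = - delta /\ - delta < 0 /\
     filterlim w (at_left T) (locally wT)) /\
    (novikov_solution T u /\
     forall x, u x 0 = - (b + delta) * exp (- Rabs (x + a))
                       + b * exp (- Rabs (x - a))).
Proof.
  (* The constant [4] is the reciprocal of the factor in the lower bound of [speed_bounds]. *)
  exists 4, 1; split; [lra|split; [lra|]].
  intros a b delta Ha Hb Hd.
  assert (a0 : 0 < a) by lra. assert (b0 : 0 < b) by lra.
  destruct (coef_pos a b delta a0 b0 Hd) as [HA HB].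
  set (A := coef_A a b delta) in *; set (B := coef_B a b delta) in *.
  assert (Hx0 := x_init_bounds a a0). set (x0 := x_init a) in *.
  set (r := sqrt (2 * b * (b + delta))).
  assert (Hr : 0 < r) by (apply sqrt_lt_R0; repeat apply Rmult_lt_0_compat; lra).
  destruct (decreasing_to_zero (speed A B) x0 (r * x0 * delta / 4) (sqrt (A + B) * sqrt A))
    as (T & y & T0 & HT & y0 & yT & yc & yd & yD).
  - lra.
  - repeat apply Rmult_lt_0_compat; lra.
  - intros x _; apply continuous_speed.
  - intros x Hx; now apply speed_bounds.
  - assert (E2a : exp (- 2 * a) = exp (- (2 * a))) by (f_equal; ring).
    pose (p1 := sol_p1 a b delta y); pose (p2 := sol_p2 a b delta y).
    pose (q1 := sol_q1 a b delta y); pose (q2 := sol_q2 a b delta y).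
    assert (HP : forall t, p2 t - p1 t = mom_p A B (y t)) by (intros t; apply sol_p).
    assert (HW : forall t, p1 t + p2 t = mom_w A B (y t)) by (intros t; apply sol_w).
    assert (Smooth : smooth_solution a b delta T q1 q2 p1 p2) by (apply sol_smooth; assumption).
    destruct Smooth as (Sm1 & (Iq1 & Iq2 & Ip1 & Ip2) & Sm3).
    assert (Smooth := conj Sm1 (conj (conj Iq1 (conj Iq2 (conj Ip1 Ip2))) Sm3)
              : smooth_solution a b delta T q1 q2 p1 p2).
    exists T, q1, q2, p1, p2; cbv zeta.
    split; [exact T0|]. split; [exact Smooth|].
    split.
    { intros T' r1 r2 s1 s2 T'0 Hs.
      assert (TT : T' <= T) by (eapply (sol_maximal a b delta T y); eassumption).
      split; [exact TT|]. intros t Ht.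
      apply (smooth_solution_unique a b delta T T'); auto.
      unfold lifespan in *; lra. }
    split.
    { split; [intros; apply (sol_q_pos a b delta T y); auto|apply sol_q_lim; auto]. }
    split.
    (* From [m * T <= x0] with [m = r * x0 * delta / 4]; the factor [x0] cancels. *)
    { assert (H : r * delta * T <= 4).
      { apply Rmult_le_reg_r with (x0 / 4); lra. }
      apply Rmult_le_reg_r with (delta * r); [now apply Rmult_lt_0_compat|].
      replace (4 * (1 / (delta * r)) * (delta * r)) with 4 by (field; lra). lra. }
    split.
    { intros t Ht. assert (Hy : 0 < y t < 1) by (eapply (y_lt_1 a T y); eassumption).
      assert (Hq : exp (- (q2 t - q1 t)) = exp_neg_q (y t))
        by (apply (sol_exp_q a b delta T y); auto).
      rewrite HP, HW. split; [now apply p_formula_reduced|now apply w_formula_reduced]. }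
    assert (EqP : forall f, equivalent_on (lifespan T) f (fun t => mom_p A B (y t)) ->
                    equivalent_on (lifespan T) f (fun t => p2 t - p1 t)).
    { intros f (c1 & c2 & H1 & H2 & H3); exists c1, c2; split; [exact H1|split; [exact H2|]].
      intros t Ht; rewrite HP; auto. }
    split.
    { split; [|split; [|split; [|split]]].
      - intros t Ht; split; [field|]. apply (sol_p1_neg a b delta T y); auto.
      - apply (sol_p1_decreasing a b delta T y); auto.
      - apply (sol_p1_lim a b delta T y); auto.
      - apply EqP, (sol_p1_equivalent a b delta T y); auto.
      - destruct (sol_p_equivalent a b delta T y) as (c1 & c2 & H1 & H2 & H3); auto.
        exists c1, c2; split; [exact H1|split; [exact H2|]].
        intros t Ht; rewrite HP; exact (H3 t Ht). }
    split.
    { split; [|split; [|split]].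
      - intros t Ht; split; [field|]. apply (sol_p2_pos a b delta T y); auto.
      - apply (sol_p2_increasing a b delta T y); auto.
      - apply (sol_p2_lim a b delta T y); auto.
      - apply EqP, (sol_p2_equivalent a b delta T y); auto. }
    split.
    { split; [|split; [|split]].
      - intros s t Hs Ht st; rewrite !HW. apply (sol_w_decreasing a b delta T y); auto.
      - rewrite Ip1, Ip2; ring.
      - lra.
      - rewrite E2a, <- (coef_A_alt a b delta a0). apply (sol_w_lim a b delta T y); auto. }
    split; [apply (sol_novikov a b delta T y); auto|].
    intros x; unfold two_peakon; rewrite Iq1, Iq2, Ip1, Ip2.
    replace (x - - a) with (x + a) by ring. ring.
Qed.
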